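(* Let $d\ge2$, let $p=(p_1,\dots,p_d)\in(0,1)^d$ with $p_d\le\dots\le p_2<p_1$, let $\sigma\in(0,1]$, and let $\gamma_n=\gamma_1n^{-\alpha}$, $\rho_n=\rho_1n^{-\beta}$ for $n\ge 1$, with $\alpha,\beta\in(0,+\infty)$ and $(\gamma_1,\rho_1)\in(0,1)^2$. Let $\Pi_n=(X_n^1,\dots,X_n^d)$, $n\ge0$, be the multi-armed $\sigma$-over-penalized Narendra-Shapiro algorithm with these parameters. Then: (i) If $0<\beta\le\alpha$ and $\alpha+\beta\le1$, then $\lim_{n\to+\infty}\Pi_n=(1,0,\dots,0)$ almost surely. (ii) Furthermore, if $0<\beta<\alpha$ and $\alpha+\beta<1$, then $$\forall i\in\{2,\dots,d\},\qquad \frac{X_n^i}{\rho_n}\longrightarrow\frac{1-\sigma p_1}{(d-1)(p_1-p_i)}\quad\text{almost surely.}$$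
   Context: The multi-armed $\sigma$-over-penalized Narendra-Shapiro algorithm: arm $j\in\{1,\dots,d\}$ produces i.i.d. rewards $A_n^j\sim\mathcal B(p_j)$, $n\ge1$, independent across arms; $(B_n^\sigma)_{n\ge1}$ are i.i.d. Bernoulli variables with $\mathbb P(B_n^\sigma=1)=\sigma$, independent of the rewards. $\Pi_n=(X_n^1,\dots,X_n^d)$ is a probability vector, started from a fixed deterministic $\Pi_0$ with positive coordinates. Given the history up to time $n$, the arm $I_{n+1}\in\{1,\dots,d\}$ is drawn with $\mathbb P(I_{n+1}=j\mid \text{history})=X_n^j$, independently of $(A_{n+1}^\cdot,B_{n+1}^\sigma)$, which are themselves independent of the history, and for each $j\in\{1,\dots,d\}$ $$X_{n+1}^j=X_n^j+\gamma_{n+1}\left[\mathbf 1_{\{I_{n+1}=j\}}-X_n^j\right]A_{n+1}^{I_{n+1}}-\gamma_{n+1}\rho_{n+1}X_n^{I_{n+1}}\left(1-A_{n+1}^{I_{n+1}}B_{n+1}^\sigma\right)\left[\mathbf 1_{\{I_{n+1}=j\}}-\frac{1-\mathbf 1_{\{I_{n+1}=j\}}}{d-1}\right].$$ *)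

(* Defs.v *)
From mathcomp Require Export all_boot all_order all_algebra.
From mathcomp Require Export all_classical all_reals all_analysis.
Set Implicit Arguments.
Unset Strict Implicit.
Unset Printing Implicit Defensive.
Export Order.TTheory GRing.Theory Num.Theory.
Export numFieldNormedType.Exports.

Local Open Scope classical_set_scope.
Local Open Scope ring_scope.

Section Probability.
Context (disp : measure_display) (T : measurableType disp) (R : realType)
  (P : probability T R).

Definition mutually_independent (disp' : measure_display)
    (T' : measurableType disp') (K : eqType) (Y : K -> {RV P >-> T'}) : Prop :=
  forall (s : seq K) (S : K -> set T'), uniq s ->
    (forall k, measurable (S k)) ->
    P (\bigcap_(k in [set` s]) (Y k @^-1` S k))
      = (\prod_(k <- s) P (Y k @^-1` S k))%E.

Definition independent_systems (F G : set_system T) : Prop :=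
  forall E H, F E -> G H -> P (E `&` H) = (P E * P H)%E.

(* [f] is a version of P(E | F), for a sub-sigma-algebra [F] *)
Definition is_cond_prob (F : set_system T) (E : set T) (f : T -> R) : Prop :=
  [/\ forall S : set R, measurable S -> F (f @^-1` S),
      P.-integrable setT (EFin \o f) &
      forall H, F H -> (\int[P]_(w in H) (f w)%:E)%E = P (H `&` E)].

End Probability.

Section NarendraShapiro.
Context (d : nat).

(* Arms are numbered from 0: the arm j of the paper is the ordinal j - 1. *)
Definition arm1 (hd : (1 < d)%N) : 'I_d := Ordinal (ltnW hd).
Definition arm2 (hd : (1 < d)%N) : 'I_d := Ordinal hd.

Definition power_step (R : realType) (c a : R) (n : nat) : R :=
  c * n%:R `^ (- a).

(* One round from [x], with steps [g], [r]: arm [i] is drawn, its reward is [a],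
   and [b] is the Bernoulli(sigma) variable of the round. *)
Definition ns_step (R : realType) (g r : R) (x : 'rV[R]_d) (i : 'I_d)
    (a b : bool) : 'rV[R]_d :=
  \row_j (x 0 j + g * ((i == j)%:R - x 0 j) * a%:R
          - g * r * x 0 i * (1 - a%:R * b%:R)
            * ((i == j)%:R - (1 - (i == j)%:R) / (d%:R - 1))).

Section Algorithm.
Context (disp : measure_display) (T : measurableType disp) (R : realType)
  (P : probability T R).
Context (A : nat -> 'I_d -> {RV P >-> bool}) (B : nat -> {RV P >-> bool})
  (I : nat -> T -> 'I_d).

(* Rounds are numbered from 1, so that the variables at time 0 are dummies:
   nothing below refers to them. *)

Definition noise (k : nat * 'I_d + nat) : {RV P >-> bool} :=
  match k with
  | inl (n, j) => A n.+1 j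
  | inr n => B n.+1
  end.

(* All the variables are discrete, whence preimages of arbitrary sets. *)
Definition outcome_events (n : nat) : set_system T :=
  (\bigcup_(j : 'I_d) preimage_set_system setT (A n j) setT)
    `|` preimage_set_system setT (B n) setT.

Definition arm_events (n : nat) : set_system T :=
  preimage_set_system setT (I n) setT.

Definition past_events (n : nat) : set_system T :=
  \bigcup_(k in [set k | (0 < k <= n)%N]) (outcome_events k `|` arm_events k).

Definition outcome (n : nat) : set_system T := <<s outcome_events n >>.

(* As the initial state is deterministic, the history is generated by the
   rewards of all arms, the variables B and the arms drawn, up to time n. *)
Definition history (n : nat) : set_system T := <<s past_events n >>.

Definition history_and_arm (n : nat) : set_system T :=
  <<s past_events n `|` arm_events n.+1 >>.

Record over_penalized_NS (p : 'I_d -> R) (sigma : R) (gamma rho : nat -> R)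
    (x0 : 'rV[R]_d) (X : nat -> T -> 'rV[R]_d) : Prop := {
  ns_init_pos : forall j, 0 < x0 0 j ;
  ns_init_sum : \sum_j x0 0 j = 1 ;
  ns_reward_law : forall n j,
    distribution P (A n.+1 j) = bernoulli_prob (p j) :> (set bool -> \bar R) ;
  ns_bernoulli_law : forall n,
    distribution P (B n.+1) = bernoulli_prob sigma :> (set bool -> \bar R) ;
  ns_noise_indep : mutually_independent noise ;
  ns_arm_measurable : forall n j, measurable (I n.+1 @^-1` [set j]) ;
  ns_arm_law : forall n j,
    is_cond_prob P (history n) (I n.+1 @^-1` [set j]) (fun w => X n w 0 j) ;
  (* both the history and the choice of the next arm are independent of the
     next outcomes *)
  ns_fresh : forall n,
    independent_systems P (history_and_arm n) (outcome n.+1) ;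
  ns_start : forall w, X 0%N w = x0 ;
  ns_rec : forall n w,
    X n.+1 w = ns_step (gamma n.+1) (rho n.+1) (X n w) (I n.+1 w)
                 (A n.+1 (I n.+1 w) w) (B n.+1 w)
}.

End Algorithm.
End NarendraShapiro.

(* Main.v *)
(* The state stays in the simplex, so all expectations E f(X_n) are finite sums,
   obtained by iterating the one-round transition operator on f; no martingale
   argument is needed.

   With X the weight of the best arm, y = 1 - X and s = y / (X + K rho), the
   penalty keeps the drift of X of order gamma rho near X = 0, where the
   variance of an increment is of order gamma^2 (X + rho^2). As gamma = O(rho),
   a second order expansion gives, for each power m and K large enough,
     E s_{n+1}^m <= (1 - kappa gamma) E s_n^m + O(gamma rho^m),
   whence E y_n^m = O(rho_n^m). Taking m beta >= 2, Markov's inequality and the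
   Borel-Cantelli lemma give y_n -> 0 almost surely.

   For (ii), w = X^i - c rho, with c the claimed limit of X^i / rho, has drift
   - gamma (p_1 - p_i) w up to terms that the moments of y make negligible;
   hence E w_n^(2k) = O(rho_n^(2k) n^(- e k)) with
   e = min(beta, 1 - alpha, alpha - beta), and Borel-Cantelli applies again. *)
Require Import Defs.
From mathcomp Require Import ring lra.

Set Implicit Arguments.
Unset Strict Implicit.
Unset Printing Implicit Defensive.

Local Open Scope classical_set_scope.
Local Open Scope ring_scope.

(** * The law of the state *)

(** The obstacle is the neighbourhood of X = 0. There y decreases through a drift of order gamma X
    y, which is no contraction of y. Dividing y by X gives a relative decay of order gamma, but y /
    X is unbounded, and K rho in the denominator caps it. Where X is below K rho, the penalties paid
    by the other arms feed X at rate c gamma rho y^2; divided by X + K rho, this is again a relative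
    decay, of order gamma / K. Curvature and variance of s are smaller than these drifts by a factor
    gamma / (X + K rho), at most C / K if gamma <= C rho. Hence beta <= alpha, K large, and kappa of
    order 1 / K. The decay kappa gamma_n must also beat the relative variation of rho_n, of order 1
    / n, whence alpha < 1.

    In (ii) the target c rho_n moves. The three terms of e make three errors negligible: beta for
    those quadratic in y and rho, 1 - alpha for the displacement of the target, of order rho_n / n
    against gamma_n rho_n, and alpha - beta for the noise, whose variance over gamma is of order
    gamma rho against rho^2. *)

Section GeneratedSigmaAlgebra.
Context (T : Type) (G : set_system T).

Lemma gen_set0 : <<s G >> set0.
Proof. by have [] := smallest_sigma_algebra setT G. Qed.

Lemma gen_setT : <<s G >> setT.
Proof.
by have [h0 hC _] := smallest_sigma_algebra setT G; have := hC _ h0; rewrite setD0.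
Qed.

Lemma gen_setI (E F : set T) : <<s G >> E -> <<s G >> F -> <<s G >> (E `&` F).
Proof.
have /sigma_algebraP[//|_ _ _] := smallest_sigma_algebra setT G.
by apply.
Qed.

Lemma gen_bigU (J : Type) (s : seq J) (E : J -> set T) :
  (forall j, <<s G >> (E j)) -> <<s G >> (\big[setU/set0]_(j <- s) E j).
Proof.
move=> mE; apply: (@big_ind _ (fun E => <<s G >> E)) => //; first exact: gen_set0.
have [h0 _ hU] := smallest_sigma_algebra setT G.
by move=> F H mF mH; rewrite -bigcup2E; apply: hU => -[|[|n]].
Qed.

End GeneratedSigmaAlgebra.

Section Transition.
Context (R : realType) (d : nat).
Implicit Types (f : 'rV[R]_d -> R) (x : 'rV[R]_d).

Definition bern (q : R) (b : bool) : R := if b then q else 1 - q.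

(* The outcome [(i, a, b)] of a round: arm drawn, its reward, the value of B. *)
Definition round_weight (p : 'I_d -> R) (sigma : R) x (k : 'I_d * bool * bool) : R :=
  x 0 k.1.1 * (bern (p k.1.1) k.1.2 * bern sigma k.2).

Definition round_next (g r : R) x (k : 'I_d * bool * bool) : 'rV[R]_d :=
  ns_step g r x k.1.1 k.1.2 k.2.

Definition transition p sigma g r f x : R :=
  \sum_k round_weight p sigma x k * f (round_next g r x k).

(** The expectation of [f] at time [m + k] given the state [x] at time [m]. Peeling off the first
    round suits the law of the state, where events are refined forward in time; the moment
    recursions need the last round, hence [evolve_last]. *)
Fixpoint evolve p sigma (gamma rho : nat -> R) (m k : nat) f x : R :=
  if k is k'.+1 then
    transition p sigma (gamma m.+1) (rho m.+1)
      (evolve p sigma gamma rho m.+1 k' f) x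
  else f x.

Lemma evolve_last p sigma gamma rho m k f x :
  evolve p sigma gamma rho m k.+1 f x =
  evolve p sigma gamma rho m k
    (transition p sigma (gamma (m + k).+1) (rho (m + k).+1) f) x.
Proof.
elim: k m x => [|k IH] m x; first by rewrite /= addn0.
by rewrite [LHS]/= [RHS]/=; apply: eq_bigr => j _; rewrite -addSnnS -IH.
Qed.

End Transition.

Section Law.
Context (disp : measure_display) (T : measurableType disp)
    (R : realType) (P : probability T R) (d : nat)
    (p : 'I_d -> R) (hp01 : forall j, 0 < p j < 1)
    (sigma : R) (hsigma : 0 < sigma <= 1)
    (gamma rho : nat -> R) (x0 : 'rV[R]_d)
    (A : nat -> 'I_d -> {RV P >-> bool}) (B : nat -> {RV P >-> bool})
    (I : nat -> T -> 'I_d) (X : nat -> T -> 'rV[R]_d)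
    (hX : over_penalized_NS A B I p sigma gamma rho x0 X).

Lemma history_sub (m n : nat) : (m <= n)%N ->
  history A B I m `<=` history A B I n.
Proof.
move=> mn; apply: sub_sigma_algebra2 => E [k /= /andP[k0 km] kE].
by exists k => //=; rewrite k0 (leq_trans km).
Qed.

Lemma history_measurable n : history A B I n `<=` measurable.
Proof.
apply: smallest_sub; first exact: sigma_algebra_measurable.
move=> E [[//|k] _ [[[j _]|]|]] [S _ <-]; rewrite setTI.
- exact: measurable_funPTI.
- exact: measurable_funPTI.
- rewrite (_ : _ @^-1` S = \big[setU/set0]_(j <- enum 'I_d | `[< S j >]) (I k.+1 @^-1` [set j])).
    by apply: bigsetU_measurable => j _; apply: (ns_arm_measurable hX).
  apply/seteqP; split=> w /=; rewrite -bigcup_seq_cond /=.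
    by move=> Sw; exists (I k.+1 w) => //=; rewrite mem_enum; exact/asboolP.
  by case=> j /= /andP[_ /asboolP Sj] ->.
Qed.

(** Only the reward of the drawn arm is recorded: the others do not influence the next state. *)
Definition round_event n (k : 'I_d * bool * bool) : set T :=
  I n.+1 @^-1` [set k.1.1] `&`
  (A n.+1 k.1.1 @^-1` [set k.1.2] `&` B n.+1 @^-1` [set k.2]).

Lemma history_round_event n k : history A B I n.+1 (round_event n k).
Proof.
have sub E : (outcome_events A B n.+1 `|` arm_events I n.+1) E ->
    history A B I n.+1 E.
  by move=> hE; apply: sub_sigma_algebra; exists n.+1 => //=; rewrite leqnn.
apply: gen_setI; last apply: gen_setI; apply: sub.
- by right; exists [set k.1.1] => //; rewrite setTI.
- by left; left; exists k.1.1 => //; exists [set k.1.2] => //; rewrite setTI.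
- by left; right; exists [set k.2] => //; rewrite setTI.
Qed.

Lemma round_event_cover n (E : set T) :
  E = \big[setU/set0]_k (E `&` round_event n k).
Proof.
rewrite -bigcup_seq; apply/seteqP; split=> w.
  move=> Ew; exists ((I n.+1 w, A n.+1 (I n.+1 w) w, B n.+1 w)) => //=.
  by rewrite /mkset mem_index_enum.
by case=> k _ [].
Qed.

Lemma round_event_next n k w : round_event n k w ->
  X n.+1 w = round_next (gamma n.+1) (rho n.+1) (X n w) k.
Proof.
by case: k => -[i a] b [/= hI [hA hB]]; rewrite (ns_rec hX) hI hA hB.
Qed.

(** On a round event the new state is a fixed function of the old one, so the preimage of any set
    lies in the history. The state can thus be handled without a sigma-algebra on row vectors. *)
Lemma state_history n (S : set 'rV[R]_d) : history A B I n (X n @^-1` S).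
Proof.
elim: n S => [|n IH] S.
  case: (pselect (S x0)) => Sx0.
    rewrite (_ : _ @^-1` _ = setT); first exact: gen_setT.
    by apply/seteqP; split => // w _ /=; rewrite (ns_start hX).
  rewrite (_ : _ @^-1` _ = set0); first exact: gen_set0.
  by apply/seteqP; split => // w /=; rewrite (ns_start hX).
rewrite (round_event_cover n (X n.+1 @^-1` S)).
apply: gen_bigU => k.
rewrite (_ : _ `&` _ =
    X n @^-1` [set x | S (round_next (gamma n.+1) (rho n.+1) x k)] `&` round_event n k).
  apply: gen_setI; last exact: history_round_event.
  exact: history_sub (IH _).
apply/seteqP; split=> w [/= h hk]; split=> //=.
  by rewrite -(round_event_next hk).
by rewrite (round_event_next hk).
Qed.

Lemma state_measurable n S : measurable (X n @^-1` S).
Proof. by apply: (@history_measurable n); exact: state_history. Qed.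

Lemma bernoulli_prob1 (q : R) b : 0 <= q <= 1 ->
  bernoulli_prob q [set b] = (bern q b)%:E.
Proof.
move=> q01; rewrite bernoulli_probE// !diracE !in_set1.
by case: b; rewrite /= mule1 mule0 ?adde0 ?add0e.
Qed.

(** Freshness splits off the outcome of the round, [ns_arm_law] gives the weight of the arm, and the
    independence of the noise separates the reward from [B]. *)
Lemma prob_round n (E : set T) x k : history A B I n E ->
  (forall w, E w -> X n w = x) ->
  P (E `&` round_event n k) = (P E * (round_weight p sigma x k)%:E)%E.
Proof.
case: k => -[i a] b hE hx; rewrite /round_event /round_weight /=.
rewrite setIA (ns_fresh hX (n := n)); last 2 first.
- apply: gen_setI.
    by apply: sub_sigma_algebra2 hE; left.
  by apply: sub_sigma_algebra; right; exists [set i] => //; rewrite setTI.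
- apply: gen_setI; apply: sub_sigma_algebra.
    by left; exists i => //; exists [set a] => //; rewrite setTI.
  by right; exists [set b] => //; rewrite setTI.
have [_ _ /(_ E hE) <-] := ns_arm_law hX n i.
(* The state is constant on [E], so the conditional probability of the arm is integrated as a
   constant. *)
rewrite (eq_integral (fun=> (x 0 i)%:E)); last by move=> w; rewrite inE => /hx ->.
rewrite integral_cst//=; last exact: history_measurable hE.
rewrite EFinM muleA (muleC (x 0 i)%:E); congr (_ * _)%E.
pose S (k : nat * 'I_d + nat) : set bool := if k is inl _ then [set a] else [set b].
have := @ns_noise_indep _ _ _ _ _ _ _ _ _ _ _ _ _ _ hX [:: inl (n, i); inr n] S.
rewrite !big_cons big_nil mule1.
have -> : \bigcap_(k in [set` [:: inl (n, i); inr n]]) (noise A B k @^-1` S k) =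
    A n.+1 i @^-1` [set a] `&` B n.+1 @^-1` [set b].
  by rewrite bigcap_seq !big_cons big_nil setIT.
move=> -> //; rewrite EFinM; congr (_ * _)%E.
  rewrite -bernoulli_prob1; last by case/andP: (hp01 i) => /ltW -> /ltW ->.
  by rewrite -(ns_reward_law hX n i).
rewrite -bernoulli_prob1; last by case/andP: hsigma => /ltW -> ->.
by rewrite -(ns_bernoulli_law hX n).
Qed.

Lemma prob_bigU_le (K : Type) (s : seq K) (F : K -> set T) :
  (forall k, measurable (F k)) ->
  (P (\big[setU/set0]_(k <- s) F k) <= \sum_(k <- s) P (F k))%E.
Proof.
move=> mF; elim: s => [|k s IH]; first by rewrite !big_nil measure0.
rewrite !big_cons; apply: le_trans (leeD2l _ IH).
by apply: measureU2 => //; exact: bigsetU_measurable.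
Qed.

(** The first round cuts [E] into pieces on which the next state is again constant, and the
    induction runs on these. An upper bound is enough for Markov's inequality, so subadditivity
    stands in for disjointness of the pieces. *)
Lemma prob_state_le m k (E : set T) x (S : set 'rV[R]_d) : history A B I m E ->
  (forall w, E w -> X m w = x) ->
  (P (E `&` X (m + k)%N @^-1` S) <= P E * (evolve p sigma gamma rho m k \1_S x)%:E)%E.
Proof.
elim: k m E x => [|k IH] m E x hE hx.
  have mE := history_measurable hE.
  rewrite addn0 /= indicE; case: (boolP (x \in S)) => [_|/negP xS].
    rewrite mule1; apply: le_measure; rewrite ?inE//.
    exact: (measurableI _ _ mE (state_measurable m S)).
  rewrite mule0 (_ : _ `&` _ = set0) ?measure0//.
  by apply/seteqP; split => // w [Ew]; rewrite /= (hx _ Ew) -in_setE => /xS.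
have hF j : history A B I m.+1 (E `&` round_event m j).
  by apply: gen_setI; [exact: history_sub (leqnSn _) _ hE|exact: history_round_event].
rewrite {1}(round_event_cover m E) big_distrl /=.
apply: le_trans (prob_bigU_le _ _) _.
  by move=> j; apply: measurableI; [exact: history_measurable (hF j)|exact: state_measurable].
have [c PE] : exists c, P E = c%:E.
  by exists (fine (P E)); rewrite fineK// fin_num_measure//; exact: history_measurable hE.
rewrite /transition /= PE -EFinM mulr_sumr -sumEFin; apply: lee_sum => j _.
rewrite -addSnnS; apply: le_trans (IH _ _ (round_next (gamma m.+1) (rho m.+1) x j) (hF j) _) _.
  by move=> w [Ew hw]; rewrite (round_event_next hw) (hx _ Ew).
by rewrite (prob_round j hE hx) PE -!EFinM lee_fin -mulrA.
Qed.

Lemma prob_state n (S : set 'rV[R]_d) :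
  (P (X n @^-1` S) <= (evolve p sigma gamma rho 0 n \1_S x0)%:E)%E.
Proof.
have hT : history A B I 0 setT by exact: gen_setT.
have := prob_state_le n S hT (fun w _ => ns_start hX w).
by rewrite setTI add0n probability_setT mul1e.
Qed.

End Law.

(** * One round of the algorithm *)

Definition simplex (R : realType) (d : nat) (x : 'rV[R]_d) : Prop :=
  (forall j, 0 <= x 0 j) /\ \sum_j x 0 j = 1.

Section OneRound.
Context (R : realType) (d : nat) (hd : (1 < d)%N)
    (p : 'I_d -> R) (hp01 : forall j, 0 < p j < 1)
    (sigma : R) (hsigma : 0 < sigma <= 1).
Implicit Types (x : 'rV[R]_d) (g r : R).

Local Notation W := (round_weight p sigma).

Lemma sum_round (F : 'I_d * bool * bool -> R) :
  \sum_k F k = \sum_i (F (i, true, true) + F (i, true, false)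
                       + (F (i, false, true) + F (i, false, false))).
Proof.
transitivity (\sum_(k : 'I_d * bool) \sum_b F (k, b)).
  by rewrite [RHS]pair_bigA; apply: eq_bigr => -[].
transitivity (\sum_i \sum_a \sum_b F (i, a, b)).
  by rewrite [RHS]pair_bigA; apply: eq_bigr => -[].
by apply: eq_bigr => i _; rewrite big_bool /= !big_bool.
Qed.

Lemma round_weight_ge0 x k : (forall j, 0 <= x 0 j) -> 0 <= W x k.
Proof.
move=> hx; case: k => -[i a] b; rewrite /round_weight /= !mulr_ge0 //.
  by rewrite /bern; case/andP: (hp01 i) => ? ?; case: a; rewrite ?subr_ge0 ltW.
by rewrite /bern; case/andP: hsigma => ? ?; case: b; rewrite ?subr_ge0// ltW.
Qed.

Lemma sum_round_weight x : simplex x -> \sum_k W x k = 1.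
Proof.
move=> [_ <-]; rewrite sum_round; apply: eq_bigr => i _.
by rewrite /round_weight /bern /=; ring.
Qed.

Lemma natrB1_ge1 : (1 : R) <= d%:R - 1.
Proof. by rewrite -(natrB _ (ltnW hd)) ler1n subn_gt0. Qed.

Lemma simplex_le1 x j : simplex x -> x 0 j <= 1.
Proof.
move=> [x0 <-]; rewrite (bigD1 j)//= lerDl sumr_ge0//.
Qed.

Lemma sum_others x j : simplex x -> \sum_(i | i != j) x 0 i = 1 - x 0 j.
Proof. by move=> [_ <-]; rewrite [in RHS](bigD1 j)//= [X in _ = X - _]addrC addrK. Qed.

Lemma penalty01 (a b : bool) : 0 <= (1 - a%:R * b%:R : R) <= 1.
Proof. by case: a; case: b; rewrite ?mulr1 ?mulr0 ?subrr ?subr0 lexx ler01. Qed.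

(** Arm [j] loses at most [g * x 0 j], either to the reward of another arm or to its own penalty,
    and these never happen in the same round. The bound gives positivity, and later keeps the
    denominator of the odds from collapsing in one round. *)
Lemma round_next_ge g r x k j : simplex x -> 0 <= g <= 1 -> 0 <= r <= 1 ->
  (1 - g) * x 0 j <= round_next g r x k 0 j.
Proof.
move=> hx /andP[g0 g1] /andP[r0 r1]; rewrite /round_next /ns_step mxE.
have xj0 := hx.1 j; have xj1 := simplex_le1 j hx.
case: k => -[i a] b /=; have xi0 := hx.1 i.
move: (penalty01 a b); set t := 1 - _ => /andP[t0 t1]; clearbody t.
case: (eqVneq i j) => [<-|ij] /=.
  rewrite ?mulr1n subrr mul0r subr0 mulr1.
  have grt : g * r * x 0 i * t <= g * x 0 i.
    rewrite (_ : _ * t = g * x 0 i * (r * t)); last by ring.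
    by rewrite ler_piMr ?mulr_ge0// mulr_ile1.
  have gx : 0 <= g * (1 - x 0 i) by rewrite mulr_ge0// subr_ge0 simplex_le1.
  by case: a => /=; rewrite ?mulr1n ?mulr0n; lra.
have dg := natrB1_ge1.
rewrite ?mulr0n sub0r subr0 -subr_ge0.
have -> : x 0 j + g * (- x 0 j) * a%:R - g * r * x 0 i * t * (0 - 1 / (d%:R - 1)) - (1 - g) * x 0 j
  = g * x 0 j * (1 - a%:R) + g * r * x 0 i * t / (d%:R - 1) by field; lra.
rewrite addr_ge0 ?mulr_ge0 ?invr_ge0//; last lra.
by case: a {t t0 t1} => /=; rewrite ?mulr1n ?mulr0n; lra.
Qed.

Lemma simplex_next g r x k : simplex x -> 0 <= g <= 1 -> 0 <= r <= 1 ->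
  simplex (round_next g r x k).
Proof.
move=> hx hg hr; split=> [j|].
  apply: le_trans (round_next_ge k j hx hg hr).
  by rewrite mulr_ge0//; [rewrite subr_ge0; case/andP: hg|exact: hx.1].
case: k => -[i a] b; rewrite /round_next /ns_step /=.
have dg := natrB1_ge1.
under eq_bigr do rewrite mxE.
have si : \sum_j ((i == j)%:R : R) = 1.
  rewrite (bigD1 i)//= eqxx big1 ?addr0// => j /negPf ji.
  by rewrite eq_sym ji.
rewrite sumrB big_split /= hx.2 -mulr_sumr -mulr_suml -mulr_sumr.
rewrite !sumrB si hx.2 subrr mulr0 mul0r addr0 -mulr_suml sumrB si sumr_const card_ord.
by rewrite divff ?subrr ?mulr0 ?subr0//; lra.
Qed.

(** The [g] term is the replicator field. In the [g * r] term, [1 - sigma * p i] is the probability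
    that drawing arm [i] leads to a penalty, and one factor [x 0 i] is the probability of drawing
    it. *)
Lemma mean_increment g r x j :
  \sum_k W x k * (round_next g r x k 0 j - x 0 j) =
  g * x 0 j * (p j - \sum_i x 0 i * p i)
  - g * r * (x 0 j ^+ 2 * (1 - sigma * p j)
       - (\sum_(i | i != j) x 0 i ^+ 2 * (1 - sigma * p i)) / (d%:R - 1)).
Proof.
have dg := natrB1_ge1.
rewrite sum_round.
under eq_bigr => i _.
  rewrite /round_weight /round_next /ns_step /bern /= !mxE ?mulr1n ?mulr0n.
  rewrite (_ : _ + _ = g * ((i == j)%:R - x 0 j) * (x 0 i * p i)
    - g * r * (x 0 i ^+ 2 * (1 - sigma * p i) * ((i == j)%:R - (1 - (i == j)%:R) / (d%:R - 1)))); last by field; lra.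
  over.
rewrite sumrB -mulr_sumr; congr (_ - _ * _).
  rewrite (bigD1 j)//= eqxx [in RHS](bigD1 j)//=.
  under eq_bigr => i /negPf ij do rewrite ij sub0r mulrN mulNr -mulrA.
  by rewrite sumrN -!mulr_sumr; ring.
rewrite (bigD1 j)//= eqxx.
under eq_bigr => i /negPf ij do rewrite ij sub0r subr0 mul1r mulrN.
by rewrite sumrN -mulr_suml ?mulr1n subrr mul0r subr0 mulr1.
Qed.

(** The case distinction serves the variance: the jump [1 - x 0 j] requires arm [j] to be drawn,
    which has probability [x 0 j]. *)
Lemma increment_bound g r x k j : simplex x -> 0 <= g -> 0 <= r ->
  `|round_next g r x k 0 j - x 0 j| <=
  g * ((if k.1.1 == j then 1 - x 0 j else x 0 j) + r).
Proof.
move=> hx g0 r0; rewrite /round_next /ns_step mxE.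
have xj0 := hx.1 j; have xj1 := simplex_le1 j hx.
case: k => -[i a] b /=; have xi0 := hx.1 i; have xi1 := simplex_le1 i hx.
move: (penalty01 a b); set t := 1 - _ => /andP[t0 t1]; clearbody t.
have dg := natrB1_ge1.
set u := (_ - (_ - _) / _).
have u1 : `|u| <= 1.
  rewrite /u; case: (i == j); rewrite ?mulr1n ?mulr0n ?subrr ?mul0r ?subr0 ?normr1//.
  rewrite sub0r normrN mul1r normfV invf_le1 ger0_norm; lra.
have -> : x 0 j + g * ((i == j)%:R - x 0 j) * a%:R - g * r * x 0 i * t * u - x 0 j
  = g * (((i == j)%:R - x 0 j) * a%:R - r * (x 0 i * t * u)) by ring.
rewrite normrM (ger0_norm g0) ler_wpM2l//.
apply: le_trans (ler_normB _ _) _; apply: lerD.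
  rewrite normrM -[leRHS]mulr1 ler_pM//.
    by case: eqP => _; rewrite ?mulr1n ?mulr0n ?sub0r ?normrN ger0_norm// subr_ge0.
  by case: a {t t0 t1 u u1}; rewrite ?normr1 ?normr0.
rewrite normrM (ger0_norm r0) -[leRHS]mulr1 ler_wpM2l//.
rewrite !normrM (ger0_norm xi0) (ger0_norm t0) -[leRHS]mulr1 ler_pM//.
  by rewrite mulr_ge0.
by rewrite -[leRHS]mulr1 ler_pM.
Qed.

(** Averaging the squared jumps gives X (1 - X)^2 + (1 - X) X^2 = X (1 - X). The factor 2 comes from
    (v + r)^2 <= 2 (v^2 + r^2). *)
Lemma second_moment_increment g r x j : simplex x -> 0 <= g -> 0 <= r ->
  \sum_k W x k * (round_next g r x k 0 j - x 0 j) ^+ 2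
    <= 2 * g ^+ 2 * (x 0 j * (1 - x 0 j) + r ^+ 2).
Proof.
move=> hx g0 r0.
pose v (i : 'I_d) := if i == j then 1 - x 0 j else x 0 j.
have bd k : W x k * (round_next g r x k 0 j - x 0 j) ^+ 2
    <= W x k * (2 * g ^+ 2 * (v k.1.1 ^+ 2 + r ^+ 2)).
  apply: ler_wpM2l; first exact: round_weight_ge0 hx.1.
  rewrite -real_normK ?num_real//.
  apply: (@le_trans _ _ ((g * (v k.1.1 + r)) ^+ 2)).
    by rewrite lerXn2r ?nnegrE// ?increment_bound// mulr_ge0// addr_ge0//;
     rewrite /v; case: eqP => _; rewrite ?subr_ge0 ?simplex_le1 ?(hx.1).
  rewrite exprMn (mulrC 2) -(mulrA (g ^+ 2)) ler_wpM2l ?exprn_ge0//.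
  have := sqr_ge0 (v k.1.1 - r); nra.
apply: le_trans (ler_sum _ (fun k _ => bd k)) _.
rewrite sum_round.
under eq_bigr => i _.
  rewrite /round_weight /bern /=.
  rewrite (_ : _ + _ = 2 * g ^+ 2 * (x 0 i * v i ^+ 2) + 2 * g ^+ 2 * r ^+ 2 * x 0 i); last by ring.
  over.
rewrite big_split /= -!mulr_sumr hx.2 (bigD1 j)//= {1}/v eqxx.
under eq_bigr => i /negPf ij do rewrite /v ij.
rewrite -mulr_suml sum_others// le_eqVlt; apply/orP; left; apply/eqP; ring.
Qed.

End OneRound.

(** * Drift and moment expansion *)

Section Drift.
Context (R : realType) (d : nat) (hd : (1 < d)%N)
    (p : 'I_d -> R) (hp01 : forall j, 0 < p j < 1)
    (sigma : R) (hsigma : 0 < sigma <= 1)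
    (o : 'I_d) (delta : R) (hdelta : 0 < delta)
    (hgap : forall i, i != o -> p i <= p o - delta).
Implicit Types (x : 'rV[R]_d) (g r : R).

Local Notation W := (round_weight p sigma).

Lemma failure_prob_gt0 i : 0 < 1 - sigma * p i.
Proof. by have := hp01 i; have := hsigma => /andP[? ?] /andP[? ?]; nra. Qed.

Lemma failure_prob_le1 i : 1 - sigma * p i <= 1.
Proof. by have := hp01 i; have := hsigma => /andP[? ?] /andP[? ?]; nra. Qed.

Lemma failure_prob_best i : 1 - sigma * p o <= 1 - sigma * p i.
Proof.
case: (eqVneq i o) => [->//|/hgap hi]; have := hsigma => /andP[? ?].
by rewrite lerD2l lerN2 ler_wpM2l//; move: hdelta hi; lra.
Qed.

(** Cauchy-Schwarz over the [d - 1] other arms, read off the squared deviations from their mean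
    [t]. *)
Lemma sum_sqr_others x : simplex x ->
  (1 - x 0 o) ^+ 2 / (d%:R - 1) <= \sum_(i | i != o) x 0 i ^+ 2.
Proof.
move=> hx; have dg := natrB1_ge1 R hd.
set t := (1 - x 0 o) / (d%:R - 1).
have cardo : \sum_(i : 'I_d | i != o) t ^+ 2 = (d%:R - 1) * t ^+ 2.
  have : \sum_(i : 'I_d) t ^+ 2 = d%:R * t ^+ 2 by rewrite sumr_const card_ord mulr_natl.
  by rewrite (bigD1 o)//= => /(canRL (addKr _)) ->; ring.
have : 0 <= \sum_(i | i != o) (x 0 i - t) ^+ 2 by apply: sumr_ge0 => i _; exact: sqr_ge0.
under eq_bigr do rewrite sqrrB -mulr_natr -mulrA mulrC.
rewrite big_split /= sumrB cardo -mulr_sumr sum_others// => h.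
rewrite -subr_ge0; apply: le_trans h _; rewrite le_eqVlt; apply/orP; left; apply/eqP.
by rewrite /t; field; lra.
Qed.

Lemma mean_gap x : simplex x -> p o - \sum_i x 0 i * p i = \sum_(i | i != o) x 0 i * (p o - p i).
Proof.
move=> hx; under [RHS]eq_bigr do rewrite mulrBr.
rewrite sumrB -mulr_suml sum_others// (bigD1 o)//=; ring.
Qed.

Lemma mean_gap_ge x : simplex x -> delta * (1 - x 0 o) <= p o - \sum_i x 0 i * p i.
Proof.
move=> hx; rewrite mean_gap// -(sum_others o hx) mulr_sumr; apply: ler_sum => i /hgap.
by move=> hi; rewrite mulrC ler_wpM2l ?(hx.1)//; lra.
Qed.

Lemma mean_gap_le x : simplex x -> p o - \sum_i x 0 i * p i <= 1 - x 0 o.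
Proof.
move=> hx; rewrite mean_gap// -(sum_others o hx); apply: ler_sum => i _.
by rewrite ler_piMr ?(hx.1)//; have := hp01 i; have := hp01 o => /andP[? ?] /andP[? ?]; lra.
Qed.

(** The [r] term balances the penalties received from the other arms and those paid. One factor
    [d - 1] comes from the sharing of a penalty, the other from [sum_sqr_others]. At X = 0 what is
    received is the whole drift. *)
Lemma best_drift g r x : simplex x -> 0 <= g -> 0 <= r ->
  g * (delta * x 0 o * (1 - x 0 o)
    + r * ((1 - sigma * p o) / (d%:R - 1) ^+ 2 * (1 - x 0 o) ^+ 2 - x 0 o ^+ 2))
  <= \sum_k W x k * (round_next g r x k 0 o - x 0 o).
Proof.
move=> hx g0 r0; have dg := natrB1_ge1 R hd; rewrite mean_increment//.
rewrite -!mulrA -mulrBr ler_wpM2l// addrC mulrC [delta * _]mulrC.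
have h1 := ler_wpM2l (hx.1 o) (mean_gap_ge hx).
set S := \sum_(i | i != o) _.
have h2 : (1 - sigma * p o) / (d%:R - 1) * (1 - x 0 o) ^+ 2 <= S.
  rewrite mulrAC -mulrA; apply: le_trans (ler_wpM2l (ltW (failure_prob_gt0 o)) (sum_sqr_others hx)) _.
  rewrite mulr_sumr /S; apply: ler_sum => i _.
  by rewrite mulrC ler_wpM2l ?sqr_ge0// failure_prob_best.
have h3 : x 0 o ^+ 2 * (1 - sigma * p o) <= x 0 o ^+ 2.
  by rewrite ler_piMr ?sqr_ge0// failure_prob_le1.
have h4 : (1 - sigma * p o) / (d%:R - 1) ^+ 2 * (1 - x 0 o) ^+ 2 <= S / (d%:R - 1).
  rewrite ler_pdivlMr; last lra.
  by apply: le_trans h2; rewrite le_eqVlt; apply/orP; left; apply/eqP; field; lra.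
have := ler_wpM2l r0 (lerB h4 h3); lra.
Qed.

(** Linearization at the vertex of the best arm: arm [i] decays at rate [p o - p i] and receives its
    share of the penalties of [o]. The remainder is quadratic in y for the replicator part and of
    order [r * y] for the penalties. *)
Lemma other_drift g r x i : i != o -> simplex x -> 0 <= g -> 0 <= r ->
  `|\sum_k W x k * (round_next g r x k 0 i - x 0 i)
    - g * (r * ((1 - sigma * p o) / (d%:R - 1)) - (p o - p i) * x 0 i)|
  <= g * ((1 - x 0 o) ^+ 2 + 4 * r * (1 - x 0 o)).
Proof.
move=> io hx g0 r0; have dg := natrB1_ge1 R hd; rewrite mean_increment//.
set y := 1 - x 0 o; set S := \sum_(l | l != i) _; set M := \sum_i _.
set q := 1 - sigma * p o.
have y0 : 0 <= y by rewrite subr_ge0 simplex_le1.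
have y1 : y <= 1 by rewrite /y gerBl (hx.1).
have xiy : x 0 i <= y.
  by rewrite /y -(sum_others o hx) (bigD1 i)//= lerDl sumr_ge0// => l _; exact: hx.1.
have xi0 := hx.1 i.
have G0 : 0 <= p o - M by apply: le_trans (mean_gap_ge hx); rewrite mulr_ge0// ltW.
have G1 : p o - M <= y := mean_gap_le hx.
have q0 : 0 < q := failure_prob_gt0 o.
have q1 : q <= 1 := failure_prob_le1 o.
have qi0 := failure_prob_gt0 i; have qi1 := failure_prob_le1 i.
have oi : o != i by rewrite eq_sym.
have SE : S = x 0 o ^+ 2 * q + \sum_(l | (l != i) && (l != o)) x 0 l ^+ 2 * (1 - sigma * p l).
  by rewrite /S (bigD1 o).
have S0 : 0 <= S - x 0 o ^+ 2 * q.
  rewrite SE addrC addKr; apply: sumr_ge0 => l _.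
  by rewrite mulr_ge0 ?sqr_ge0// ltW// failure_prob_gt0.
have S1 : S - x 0 o ^+ 2 * q <= y.
  rewrite SE addrC addKr /y -(sum_others o hx) [leRHS](bigD1 i)//=.
  rewrite -[leLHS]add0r lerD ?(hx.1)//.
  rewrite [leLHS](eq_bigl (fun l => (l != o) && (l != i))); last by move=> l; rewrite andbC.
  apply: ler_sum => l _; have := hx.1 l; have := simplex_le1 l hx.
  by have := failure_prob_gt0 l; have := failure_prob_le1 l; nra.
have xoE : x 0 o = 1 - y by rewrite /y; ring.
(* Writing p_i - M = (p_o - M) - (p_o - p_i) isolates the linear decay; both factors of
   [x 0 i * (p o - M)] are at most [y]. *)
have -> : g * x 0 i * (p i - M) - g * r * (x 0 i ^+ 2 * (1 - sigma * p i) - S / (d%:R - 1))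
   - g * (r * (q / (d%:R - 1)) - (p o - p i) * x 0 i)
  = g * (x 0 i * (p o - M) - r * (x 0 i ^+ 2 * (1 - sigma * p i) + (q - S) / (d%:R - 1))).
  by field; lra.
rewrite normrM (ger0_norm g0) ler_wpM2l//.
apply: le_trans (ler_normB _ _) _; apply: lerD.
  by rewrite ger0_norm ?mulr_ge0// expr2 ler_pM.
rewrite normrM (ger0_norm r0) (_ : 4 * r * y = r * (4 * y)); last by ring.
rewrite ler_wpM2l//.
apply: le_trans (ler_normD _ _) _.
(* The constant 4 is 1 for the penalty of arm [i] itself plus 3 for the difference between the
   actual inflow and its value at the vertex. *)
have h1 : `|x 0 i ^+ 2 * (1 - sigma * p i)| <= y.
  by rewrite ger0_norm; [nra|rewrite mulr_ge0 ?sqr_ge0// ltW].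
have h2 : `|(q - S) / (d%:R - 1)| <= 3 * y.
  rewrite normrM normfV (ger0_norm (_ : 0 <= d%:R - 1)); last lra.
  apply: (@le_trans _ _ `|q - S|).
    by rewrite ler_pdivrMr ?ler_peMr//; lra.
  move: S0 S1; rewrite xoE ler_norml => S0 S1; apply/andP; split; nra.
lra.
Qed.

End Drift.

Section Moments.
Context (R : realFieldType).

(** Induction on the exponent n = m + 2, multiplying the remainder by a + h. The constant n^2
    survives because n^2 + n <= (n + 1)^2. *)
Lemma exprD_taylor (m : nat) (a h M : R) : `|a| + `|h| <= M ->
  `|(a + h) ^+ m.+2 - a ^+ m.+2 - m.+2%:R * a ^+ m.+1 * h|
    <= m.+2%:R ^+ 2 * h ^+ 2 * M ^+ m.
Proof.
move=> hM; have M0 : 0 <= M by apply: le_trans hM; rewrite addr_ge0.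
have aM : `|a| <= M by apply: le_trans hM; rewrite lerDl.
elim: m => [|m IH].
  rewrite (_ : _ - _ = h ^+ 2); last by ring.
  by rewrite ger0_norm ?sqr_ge0// expr0 mulr1 ler_peMl ?sqr_ge0// -natrX ler1n.
have mE : m.+3%:R = m.+2%:R + 1 :> R by rewrite natr1.
rewrite (_ : _ - _ = (a + h) * ((a + h) ^+ m.+2 - a ^+ m.+2 - m.+2%:R * a ^+ m.+1 * h)
  + m.+2%:R * h ^+ 2 * a ^+ m.+1); last by rewrite mE !exprS; ring.
apply: le_trans (ler_normD _ _) _.
have h1 : `|a + h| <= M := le_trans (ler_normD _ _) hM.
have h2 : `|m.+2%:R * h ^+ 2 * a ^+ m.+1| <= m.+2%:R * h ^+ 2 * M ^+ m.+1.
  have mh : 0 <= m.+2%:R * h ^+ 2 by rewrite mulr_ge0 ?sqr_ge0.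
  by rewrite normrM normrX (ger0_norm mh) ler_wpM2l// lerXn2r ?nnegrE.
rewrite normrM; apply: le_trans (lerD (ler_pM _ _ h1 IH) h2) _ => //.
have K0 : 0 <= h ^+ 2 * M ^+ m.+1 by rewrite mulr_ge0 ?sqr_ge0 ?exprn_ge0.
have -> : M * (m.+2%:R ^+ 2 * h ^+ 2 * M ^+ m) + m.+2%:R * h ^+ 2 * M ^+ m.+1
  = (m.+2%:R ^+ 2 + m.+2%:R) * (h ^+ 2 * M ^+ m.+1) by rewrite (exprS M m); ring.
rewrite -(mulrA (_ ^+ 2)) ler_wpM2r// mE; have : 0 <= m.+2%:R :> R by []; nra.
Qed.

Lemma moment_expansion (K : finType) (w h : K -> R) (m : nat) (a M : R) :
  (forall k, 0 <= w k) -> \sum_k w k = 1 -> (forall k, `|a| + `|h k| <= M) ->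
  \sum_k w k * (a + h k) ^+ m.+2
    <= a ^+ m.+2 + m.+2%:R * a ^+ m.+1 * (\sum_k w k * h k)
       + m.+2%:R ^+ 2 * M ^+ m * (\sum_k w k * h k ^+ 2).
Proof.
move=> w0 w1 hM; have -> : a ^+ m.+2 = \sum_k w k * a ^+ m.+2 by rewrite -mulr_suml w1 mul1r.
rewrite !mulr_sumr -!big_split /=.
apply: ler_sum => k _; have := exprD_taylor m (hM k).
move=> /(le_trans (ler_norm _)) /(ler_wpM2l (w0 k)).
move: (_ ^+ _) (a ^+ _) (a ^+ _) (M ^+ _) (_%:R) => e0 e1 e2 e3 n; lra.
Qed.

End Moments.

(** * The Lyapunov function of the best arm *)

Section Young.
Context (R : realFieldType).

(** Absorbs a cross term into an arbitrarily small multiple of the contracted quantity, at the price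
    of a pure power of [r]. *)
Lemma young_power (m : nat) (D e : R) : 0 <= D -> 0 < e ->
  exists2 C, 0 <= C & forall s r, 0 <= s -> 0 <= r ->
    D * (r * (s + r) ^+ m.+1) <= e * s ^+ m.+2 + C * r ^+ m.+2.
Proof.
(* A threshold on r / s. Below it, [D * 2 ^+ m.+1 * t <= e] lets s absorb the term; above it, s <= r
   / t and everything is a power of r. The [e] in the denominator ensures t <= 1. *)
move=> D0 e0; pose t := e / (e + D * 2 ^+ m.+1).
have D2 : 0 <= D * 2 ^+ m.+1 by rewrite mulr_ge0 ?exprn_ge0.
have den : 0 < e + D * 2 ^+ m.+1 by lra.
have t0 : 0 < t by rewrite divr_gt0.
have t1 : t <= 1 by rewrite ler_pdivrMr// mul1r; lra.
have Dt : D * 2 ^+ m.+1 * t <= e.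
  by rewrite mulrA ler_pdivrMr// mulrC ler_wpM2l//; lra.
have tp : 0 <= D * (t^-1 + 1) ^+ m.+1.
  by rewrite mulr_ge0 ?exprn_ge0// addr_ge0 ?invr_ge0// ltW.
exists (D * (t^-1 + 1) ^+ m.+1) => // s r s0 r0.
have [rs|/ltW sr] := leP r (t * s).
- apply: (@le_trans _ _ (e * s ^+ m.+2)); last first.
    by rewrite lerDl mulr_ge0 ?exprn_ge0.
  apply: (@le_trans _ _ (D * ((t * s) * (2 * s) ^+ m.+1))).
    have ts : t * s <= s by rewrite ler_piMl.
    by apply: ler_wpM2l => //; apply: ler_pM => //; [rewrite exprn_ge0//; lra|
      rewrite lerXn2r ?nnegrE//; lra].
  rewrite exprMn (_ : _ * _ = (D * 2 ^+ m.+1 * t) * s ^+ m.+2) ?ler_wpM2r ?exprn_ge0//.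
  by rewrite (exprS s m.+1); ring.
- apply: (@le_trans _ _ (D * (t^-1 + 1) ^+ m.+1 * r ^+ m.+2)); last first.
    by rewrite lerDr mulr_ge0 ?exprn_ge0// ltW.
  rewrite (exprS r m.+1) [leRHS](_ : _ = D * (r * ((t^-1 + 1) * r) ^+ m.+1)); last first.
    by rewrite exprMn; ring.
  rewrite ler_wpM2l// ler_wpM2l//.
  have ti : 0 <= t^-1 by rewrite invr_ge0 ltW.
  have st : s <= t^-1 * r by rewrite mulrC ler_pdivlMr// mulrC.
  rewrite lerXn2r ?nnegrE//; [lra|by rewrite mulr_ge0//; lra|lra].
Qed.

End Young.

Section Lyapunov.
Context (R : realType) (d : nat) (hd : (1 < d)%N)
    (p : 'I_d -> R) (hp01 : forall j, 0 < p j < 1)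
    (sigma : R) (hsigma : 0 < sigma <= 1)
    (o : 'I_d) (delta : R) (hdelta : 0 < delta)
    (hgap : forall i, i != o -> p i <= p o - delta).
Implicit Types (x : 'rV[R]_d) (g r : R).

Local Notation W := (round_weight p sigma).

Definition odds (K r : R) x : R := (1 - x 0 o) / (x 0 o + K * r).

Lemma odds_ge0 K r x : 0 <= K * r -> simplex x -> 0 <= odds K r x.
Proof.
move=> Kr hx; apply: divr_ge0; first by rewrite subr_ge0 simplex_le1.
by apply: addr_ge0 => //; exact: hx.1.
Qed.

(** The second order expansion of the moment of the odds, as a function of X alone. Since s = w v -
    1, the factor [w * v ^+ 2] is minus the derivative of s in X; the term in [2 * B * (g * v)] is
    the curvature of s, the last line is the variance. [B] bounds the growth of v in one round, and
    [(2 + B) * (s + g)] bounds s plus the size of its increment. *)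
Definition odds_drift_bound (m : nat) (B c K g r X : R) : R :=
  let y := 1 - X in let v := (X + K * r)^-1 in let s := y * v in let w := 1 + K * r in
  s ^+ m.+2
  - m.+2%:R * s ^+ m.+1 * (w * g * v ^+ 2) *
      (delta * X * y + r * (c * y ^+ 2 - X ^+ 2) - 2 * B * (g * v) * (X * y + r ^+ 2))
  + m.+2%:R ^+ 2 * ((2 + B) * (s + g)) ^+ m * (2 * w ^+ 2 * B ^+ 2 * g ^+ 2 * v ^+ 4 * (X * y + r ^+ 2)).

Lemma odds_moment_expansion (m : nat) (g1 K g r : R) x :
  g1 < 1 -> simplex x -> 0 < g <= g1 -> 0 < r <= 1 -> 0 < K -> K * r <= 1 ->
  \sum_k W x k * odds K r (round_next g r x k) ^+ m.+2 <=
  odds_drift_bound m (1 - g1)^-1 ((1 - sigma * p o) / (d%:R - 1) ^+ 2) K g r (x 0 o).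
Proof.
move=> g11 hx /andP[g0 gg1] /andP[r0 r1] K0 Kr1; rewrite /odds_drift_bound.
set c := _ / _ ^+ 2; set B := (1 - g1)^-1; set X := x 0 o; set y := 1 - X; set w := 1 + K * r.
set v := _^-1; rewrite -[y * v]/(odds K r x); set s := odds K r x.
have Kr0 : 0 < K * r by rewrite mulr_gt0.
have X0 : 0 <= X := hx.1 o.
have X1 : X <= 1 := simplex_le1 o hx.
set u := X + K * r in v *.
have u0 : 0 < u by rewrite /u; lra.
have v0 : 0 < v by rewrite invr_gt0.
have uv : u * v = 1 by rewrite divff// gt_eqF.
have B0 : 1 <= B by rewrite invf_ge1; lra.
have s0 : 0 <= s by rewrite odds_ge0// ltW.
have w0 : 0 < w by rewrite /w; lra.
have sE : s = y * v by [].
have s1E : s + 1 = w * v.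
  by rewrite sE -[X in _ + X]uv -mulrDl /w /y /u; congr (_ * _); ring.
pose h k := round_next g r x k 0 o - X.
have hge k : - (g * X) <= h k.
  have := round_next_ge hd k o hx (_ : 0 <= g <= 1) (_ : 0 <= r <= 1).
  rewrite /h => H; rewrite lerBrDr; apply: le_trans (H _ _); try lra.
  by rewrite -/X; lra.
(* One round keeps at least the fraction [1 - g1] of the denominator, so its inverse grows at most
   by the factor [B]. *)
have uhge k : (1 - g1) * u <= u + h k.
  have := hge k; have : g * X <= g1 * u by rewrite ler_pM ?(ltW g0)// /u; lra.
  lra.
have uh0 k : 0 < u + h k by apply: lt_le_trans (uhge k); rewrite mulr_gt0//; lra.
pose z k := (u + h k)^-1.
have z0 k : 0 < z k by rewrite invr_gt0.
have uz k : (u + h k) * z k = 1 by rewrite divff// gt_eqF.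
have zB k : z k <= B * v.
  by rewrite /z /B /v -invfM lef_pV2 ?posrE// mulr_gt0//; lra.
pose H k := - (w * v * z k * h k).
have sH k : odds K r (round_next g r x k) = s + H k.
  have -> : odds K r (round_next g r x k) = (y - h k) * z k * (u * v).
    by rewrite uv mulr1 /odds /z /h /y /u; congr (_ / _); ring.
  rewrite sE -[y * v]mulr1 -(uz k) /H /w /y /u; ring.
have hm : \sum_k W x k * h k ^+ 2 <= 2 * g ^+ 2 * (X * y + r ^+ 2) := second_moment_increment hd hp01 hsigma o hx (ltW g0) (ltW r0).
have hd1 : g * (delta * X * y + r * (c * y ^+ 2 - X ^+ 2)) <= \sum_k W x k * h k :=
  best_drift hd hp01 hsigma hdelta hgap hx (ltW g0) (ltW r0).
have H2 k : H k ^+ 2 <= w ^+ 2 * B ^+ 2 * v ^+ 4 * h k ^+ 2.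
  have -> : H k ^+ 2 = w ^+ 2 * v ^+ 2 * h k ^+ 2 * z k ^+ 2 by rewrite /H; ring.
  have -> : w ^+ 2 * B ^+ 2 * v ^+ 4 * h k ^+ 2 = w ^+ 2 * v ^+ 2 * h k ^+ 2 * (B * v) ^+ 2 by ring.
  apply: ler_wpM2l; first by rewrite -!exprMn sqr_ge0.
  rewrite lerXn2r ?nnegrE ?(ltW (z0 k))//.
  by rewrite mulr_ge0// ltW//; lra.
(* The identity z = v - v h z, used once, leaves the first order term exact and a remainder in
   h^2. *)
have H1 k : H k <= - (w * v ^+ 2 * h k) + w * v ^+ 3 * B * h k ^+ 2.
  have -> : H k = - (w * v ^+ 2 * h k) + w * v ^+ 2 * h k ^+ 2 * z k.
    have -> : H k = - (w * v * h k) * z k * (u * v) by rewrite uv /H; ring.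
    have -> : - (w * v ^+ 2 * h k) = - (w * v ^+ 2 * h k) * ((u + h k) * z k) by rewrite uz mulr1.
    ring.
  rewrite lerD2l (_ : w * v ^+ 3 * _ * _ = w * v ^+ 2 * h k ^+ 2 * (B * v)); last by ring.
  by apply: ler_wpM2l => //; rewrite -mulrA -exprMn mulr_ge0 ?sqr_ge0 ?(ltW w0).
(* The odds cannot fall by more than s, as they stay nonnegative; they cannot rise by more than B g
   (s + 1), as h >= - g X. *)
have Hub k : `|s| + `|H k| <= (2 + B) * (s + g).
  have gs0 : 0 <= B * g by rewrite mulr_ge0 ?(ltW g0)//; lra.
  have Hs : - s <= H k.
    suff : 0 <= s + H k by lra.
    rewrite -sH; apply: odds_ge0; first exact: ltW.
    by apply: simplex_next => //; lra.
  have Hg : H k <= B * g * (s + 1).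
    rewrite s1E (_ : H k = w * v * (z k * - h k)); last by rewrite /H; ring.
    rewrite (_ : B * g * _ = w * v * (B * g)); last by ring.
    rewrite ler_wpM2l ?mulr_ge0 ?(ltW w0) ?(ltW v0)//.
    apply: (@le_trans _ _ (z k * (g * X))).
      by rewrite ler_wpM2l ?(ltW (z0 k))// lerNl hge.
    apply: (@le_trans _ _ (B * v * (g * X))).
      by rewrite ler_wpM2r ?mulr_ge0 ?(ltW g0).
    rewrite (_ : _ * _ = B * g * (v * X)); last by ring.
    by rewrite ler_piMr// mulrC ler_pdivrMr// /u; lra.
  rewrite ger0_norm// -lerBrDl ler_norml.
  have gs : 0 <= g * s by rewrite mulr_ge0// ltW.
  have Bgs : 0 <= B * (s - g * s).
    by rewrite mulr_ge0; [|lra|rewrite -{1}[s]mul1r -mulrBl mulr_ge0//; lra].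
  have Bs : 0 <= B * s by rewrite mulr_ge0//; lra.
  by apply/andP; split; lra.
have s'0 : 0 <= m.+2%:R * s ^+ m.+1 by rewrite mulr_ge0 ?exprn_ge0.
have Mm : 0 <= m.+2%:R ^+ 2 * ((2 + B) * (s + g)) ^+ m.
  by rewrite mulr_ge0 ?sqr_ge0// exprn_ge0// mulr_ge0//; lra.
rewrite (eq_bigr (fun k => W x k * (s + H k) ^+ m.+2)); last by move=> k _; rewrite sH.
have W0 k : 0 <= W x k by apply: round_weight_ge0 hx.1.
apply: le_trans (moment_expansion m W0 (sum_round_weight p sigma hx) Hub) _.
apply: lerD; [rewrite lerD2l|].
  rewrite -mulrN -(mulrA (m.+2%:R * s ^+ m.+1)) ler_wpM2l//.
  apply: (@le_trans _ _ (- (w * v ^+ 2) * (\sum_k W x k * h k)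
      + w * v ^+ 3 * B * (\sum_k W x k * h k ^+ 2))).
    rewrite !mulr_sumr -big_split /=; apply: ler_sum => k _.
    by apply: le_trans (ler_wpM2l (W0 k) (H1 k)) _; rewrite le_eqVlt; apply/orP; left; apply/eqP; ring.
  have wv2 : 0 <= w * v ^+ 2 by rewrite mulr_ge0 ?sqr_ge0// ltW.
  have wv3 : 0 <= w * v ^+ 3 * B by rewrite !mulr_ge0 ?exprn_ge0//; lra.
  have := ler_wpM2l wv2 hd1; have := ler_wpM2l wv3 hm.
  move: (\sum_k _) (\sum_k _) => E2 E1.
  by clearbody w v c y X B; lra.
rewrite ler_wpM2l//.
apply: (@le_trans _ _ (w ^+ 2 * B ^+ 2 * v ^+ 4 * \sum_k W x k * h k ^+ 2)).
  rewrite mulr_sumr; apply: ler_sum => k _.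
  by apply: le_trans (ler_wpM2l (W0 k) (H2 k)) _; rewrite mulrCA.
rewrite (_ : 2 * _ * _ * _ * _ * _ = w ^+ 2 * B ^+ 2 * v ^+ 4 * (2 * g ^+ 2 * (X * y + r ^+ 2))); last by ring.
apply: ler_wpM2l => //.
by rewrite (_ : v ^+ 4 = (v ^+ 2) ^+ 2) -?exprMn ?sqr_ge0//; ring.
Qed.

End Lyapunov.

(** * One-round contraction of the odds, split at X = 1/2 *)

Section OddsRecursion.
Context (R : realType).
Implicit Types (n m : nat) (B C D K Q X Y Z c e g r s t u v w y delta kappa : R).

(** Far from the vertex y >= 1/2, which yields the bounds of g and v by 2 s. The variance then takes
    the shape of the curvature term, with s^(m+1) g v^2 in front; 16 = 2 * 2 * 4 collects the
    coefficient 2, v <= 2 s and w^2 <= 4. *)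
Lemma second_order_far m B Q b g s v w : 0 <= b -> 0 <= Q -> 0 <= g -> 0 <= v ->
  g <= 2 * s -> v <= 2 * s -> 0 <= w <= 2 ->
  b * (s + g) ^+ m * (2 * w ^+ 2 * B ^+ 2 * g ^+ 2 * v ^+ 4 * Q)
    <= s ^+ m.+1 * (g * v ^+ 2) * (b * 3 ^+ m * 16 * B ^+ 2 * (g * v) * Q).
Proof.
move=> b0 Q0 g0 v0 gs vs /andP[w0 w2].
have s0 : 0 <= s by lra.
have E1 : s ^+ m.+1 * (g * v ^+ 2) * (b * 3 ^+ m * 16 * B ^+ 2 * (g * v) * Q) =
   (b * B ^+ 2 * g ^+ 2 * v ^+ 3 * Q) * ((3 * s) ^+ m * (2 * s) * (2 * 4)).
  by rewrite !exprMn (exprS s m); ring.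
have E2 : b * (s + g) ^+ m * (2 * w ^+ 2 * B ^+ 2 * g ^+ 2 * v ^+ 4 * Q)
  = (b * B ^+ 2 * g ^+ 2 * v ^+ 3 * Q) * ((s + g) ^+ m * v * (2 * w ^+ 2)) by ring.
rewrite E1 E2 {E1 E2}; apply: ler_wpM2l.
  apply: mulr_ge0 => //; apply: mulr_ge0; last exact: exprn_ge0.
  by rewrite -mulrA -exprMn mulr_ge0 ?sqr_ge0.
have sg0 : 0 <= s + g by rewrite addr_ge0.
have h : (s + g) ^+ m <= (3 * s) ^+ m.
  by apply: lerXn2r; rewrite ?nnegrE; lra.
have w4 : w ^+ 2 <= 4.
  have -> : 4 = 2 ^+ 2 :> R by ring.
  by apply: lerXn2r; rewrite ?nnegrE.
apply: ler_pM.
- by apply: mulr_ge0 => //; exact: exprn_ge0.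
- by apply: mulr_ge0 => //; exact: sqr_ge0.
- by apply: ler_pM => //; exact: exprn_ge0.
- by apply: ler_wpM2l.
Qed.

(** Of [delta * X * y], one quarter pays for the outflow r X^2 and one quarter for the second order,
    leaving delta / 2 >= kappa. As r^2 <= 4 r y^2, the second order also takes at most half of c r
    y^2; the other half is at least c r y / 4 >= kappa K r y. *)
Lemma drift_far (n B D c delta kappa K X y r w gv : R) :
  0 < delta -> 0 < c -> 1 <= n -> 1 <= w <= 2 -> 0 <= B -> 0 <= gv -> 0 <= D ->
  (4 * n * B + D) * gv <= delta / 4 -> (4 * n * B + D) * gv <= c / 8 ->
  0 <= X -> X <= y -> 1 / 2 <= y -> 0 < r -> 2 * n * r <= delta / 4 -> r <= 1 ->
  kappa <= delta / 2 -> kappa * K <= c / 4 ->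
  kappa * (y * (X + K * r)) <=
    n * w * (delta * X * y + r * (c * y ^+ 2 - X ^+ 2) - 2 * B * gv * (X * y + r ^+ 2))
    - D * gv * (X * y + r ^+ 2).
Proof.
move=> delta0 c0 n1 /andP[w1 w2] B0 gv0 D0 e1 e2 X0 Xy y2 r0 nr r1 k1 k2.
have y0 : 0 <= y by lra.
have Xy0 : 0 <= X * y by rewrite mulr_ge0.
have yy : 1 / 2 * y <= y ^+ 2 by rewrite expr2 ler_wpM2r.
have r0' := ltW r0.
have nw : 1 <= n * w by rewrite -[1]mulr1 ler_pM.
have nw2 : n * w <= 2 * n by rewrite mulrC ler_wpM2r//; lra.
have n0 : 0 <= n by lra.
have h1 : delta * (X * y) <= n * w * (delta * (X * y)).
  by apply: ler_peMl => //; apply: mulr_ge0 => //; exact: ltW.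
have h2 : r * (c * y ^+ 2) <= n * w * (r * (c * y ^+ 2)).
  apply: ler_peMl => //; apply: mulr_ge0 => //.
  by apply: mulr_ge0; [exact: ltW|exact: sqr_ge0].
have h3 : n * w * (r * X ^+ 2) <= delta / 4 * (X * y).
  apply: (@le_trans _ _ (2 * n * (r * (X * y)))); last by rewrite mulrA; apply: ler_wpM2r.
  apply: ler_pM => //; first lra.
    by apply: mulr_ge0 => //; exact: sqr_ge0.
  by apply: ler_wpM2l => //; rewrite expr2; apply: ler_wpM2l.
have Q0 : 0 <= X * y + r ^+ 2 by rewrite addr_ge0 ?sqr_ge0.
have BgQ : 0 <= B * gv * (X * y + r ^+ 2) by rewrite !mulr_ge0.
have h4 := ler_wpM2r BgQ nw2.
have h5 := ler_wpM2r Xy0 e1.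
have h6 := ler_wpM2r (sqr_ge0 r) e2.
have ry : r ^+ 2 <= 4 * (r * y ^+ 2).
  have : r ^+ 2 <= r by rewrite expr2 ler_piMr.
  have : r * (1 / 4) <= r * y ^+ 2 by apply: ler_wpM2l => //; lra.
  lra.
have h7 := ler_wpM2l (ltW c0) ry.
have h7' := ler_wpM2l (ltW c0) (ler_wpM2l r0' yy).
have h8 := ler_wpM2r Xy0 k1.
have h9 := ler_wpM2r (mulr_ge0 r0' y0) k2.
clear - h1 h2 h3 h4 h5 h6 h7 h7' h8 h9; lra.
Qed.

(** Near the vertex v <= 2, and the variance reduces to the cross term that [young_power] treats;
    256 = 8 * 16 * 2. *)
Lemma second_order_near m B C Q b g r s v w : 0 <= b -> 0 <= Q -> 0 <= g -> 0 <= v <= 2 ->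
  0 <= s -> 0 <= r -> 1 <= C -> g <= C * r -> 0 <= w <= 2 -> Q <= 2 * (s + r) ->
  b * (s + g) ^+ m * (2 * w ^+ 2 * B ^+ 2 * g ^+ 2 * v ^+ 4 * Q)
    <= g * (b * 256 * B ^+ 2 * C ^+ m.+1 * (r * (s + r) ^+ m.+1)).
Proof.
move=> b0 Q0 g0 /andP[v0 v2] s0 r0 C1 gC /andP[w0 w2] Qs.
have C0 : 0 <= C by lra.
have E1 : g * (b * 256 * B ^+ 2 * C ^+ m.+1 * (r * (s + r) ^+ m.+1)) =
   b * B ^+ 2 * g * ((C * (s + r)) ^+ m * (8 * (C * r) * 16 * (2 * (s + r)))).
  by rewrite !exprMn (exprS C m) (exprS (s + r) m); ring.
have E2 : b * (s + g) ^+ m * (2 * w ^+ 2 * B ^+ 2 * g ^+ 2 * v ^+ 4 * Q)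
  = b * B ^+ 2 * g * ((s + g) ^+ m * (2 * w ^+ 2 * g * v ^+ 4 * Q)) by ring.
rewrite E1 E2 {E1 E2}; apply: ler_wpM2l.
  by apply: mulr_ge0 => //; apply: mulr_ge0 => //; exact: sqr_ge0.
have sg0 : 0 <= s + g by rewrite addr_ge0.
have CrsE : s + g <= C * (s + r).
  have : s <= C * s by rewrite ler_peMl.
  lra.
have h : (s + g) ^+ m <= (C * (s + r)) ^+ m.
  by apply: lerXn2r; rewrite ?nnegrE//; exact: le_trans CrsE.
have w4 : 2 * w ^+ 2 <= 8.
  have -> : 8 = 2 * 2 ^+ 2 :> R by ring.
  by apply: ler_wpM2l => //; apply: lerXn2r; rewrite ?nnegrE.
have v4 : v ^+ 4 <= 16.
  have -> : 16 = 2 ^+ 4 :> R by ring.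
  by apply: lerXn2r; rewrite ?nnegrE.
have v40 : 0 <= v ^+ 4 by exact: exprn_ge0.
have ww : 0 <= 2 * w ^+ 2 by apply: mulr_ge0 => //; exact: sqr_ge0.
have wwg : 0 <= 2 * w ^+ 2 * g by exact: mulr_ge0.
have wwgv : 0 <= 2 * w ^+ 2 * g * v ^+ 4 by exact: mulr_ge0.
apply: ler_pM => //; [exact: exprn_ge0|exact: mulr_ge0|].
by apply: ler_pM => //; apply: ler_pM => //; exact: ler_pM.
Qed.

(** With X v >= 1/2 the term [delta * X * y] gives the decay of s. The inflow has the favourable
    sign and is dropped; outflow and curvature are O(r), and 24 = 2 * 8 * 3/2 with v^3 <= 8 and X y
    + r^2 <= 3/2. *)
Lemma drift_near (n B C c delta X y r g v w : R) :
  0 < delta -> 0 < c -> 1 <= n -> 1 <= w <= 2 -> 1 <= B -> 0 <= g -> g <= C * r -> 0 <= C ->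
  0 <= v <= 2 -> 1 / 2 <= X * v <= 1 -> X <= 1 -> 0 <= y -> y <= 1 / 2 -> 0 < r -> r <= 1 ->
  delta / 2 * (y * v) - 2 * n * (1 + 24 * B * C) * r
  <= n * w * v ^+ 2 * (delta * X * y + r * (c * y ^+ 2 - X ^+ 2)
     - 2 * B * (g * v) * (X * y + r ^+ 2)).
Proof.
move=> delta0 c0 n1 /andP[w1 w2] B1 g0 gC C0 /andP[v0 v2] /andP[Xv1 Xv2] X1 y0 y1 r0 r1.
have r0' := ltW r0.
have nw : 1 <= n * w by rewrite -[1]mulr1 ler_pM.
have nw0 : 0 <= n * w by lra.
have nw2 : n * w <= 2 * n by rewrite mulrC ler_wpM2r//; lra.
have yv0 : 0 <= y * v by exact: mulr_ge0.
have Xyv : 1 / 2 * (y * v) <= X * v * (y * v) by exact: ler_wpM2r.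
have h1 : delta * (1 / 2 * (y * v)) <= n * w * (delta * (X * v * (y * v))).
  apply: (@le_trans _ _ (delta * (X * v * (y * v)))); first by apply: ler_wpM2l => //; exact: ltW.
  by apply: ler_peMl => //; apply: mulr_ge0; [exact: ltW|apply: mulr_ge0 => //; lra].
have h2 : 0 <= n * w * v ^+ 2 * (r * (c * y ^+ 2)).
  have v20 := sqr_ge0 v; have y20 := sqr_ge0 y.
  by apply: mulr_ge0; apply: mulr_ge0 => //; apply: mulr_ge0 => //; exact: ltW.
have h3 : n * w * (r * (X * v) ^+ 2) <= 2 * n * (r * 1).
  apply: ler_pM => //.
    by apply: mulr_ge0 => //; exact: sqr_ge0.
  apply: ler_wpM2l => //; rewrite expr2 -[1]mulr1; apply: ler_pM => //; lra.
have B0 : 0 <= B by lra.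
have v30 : 0 <= v ^+ 3 by exact: exprn_ge0.
have v3 : v ^+ 3 <= 8.
  have -> : 8 = 2 ^+ 3 :> R by ring.
  by apply: lerXn2r; rewrite ?nnegrE.
have X0 : 0 <= X.
  rewrite leNgt; apply/negP => X0.
  have : X * v <= 0 by rewrite nmulr_rle0.
  lra.
have Q0 : 0 <= X * y + r ^+ 2 by rewrite addr_ge0 ?sqr_ge0 ?mulr_ge0.
have Q1 : X * y + r ^+ 2 <= 3 / 2.
  have : X * y <= y by rewrite ler_piMl.
  have : r ^+ 2 <= r by rewrite expr2 ler_piMr.
  lra.
have h4 : n * w * (B * g * v ^+ 3 * (X * y + r ^+ 2)) <= 2 * n * (B * (C * r) * 8 * (3 / 2)).
  have Bg : 0 <= B * g by exact: mulr_ge0.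
  have Bgv : 0 <= B * g * v ^+ 3 by exact: mulr_ge0.
  apply: ler_pM => //; first exact: mulr_ge0.
  by apply: ler_pM => //; apply: ler_pM => //; exact: ler_wpM2l.
clear - h1 h2 h3 h4; lra.
Qed.

Lemma odds_drift_bound_far m (B C D c delta K kappa g r X : R) :
  D = m.+2%:R ^+ 2 * (2 + B) ^+ m * 3 ^+ m * 16 * B ^+ 2 ->
  0 < delta -> 0 < c -> 1 <= B -> 1 <= C -> 0 < K ->
  (4 * m.+2%:R * B + D) * C <= K * (delta / 4) ->
  (4 * m.+2%:R * B + D) * C <= K * (c / 8) ->
  kappa <= delta / 2 -> kappa * K <= c / 4 ->
  0 <= X <= 1 / 2 -> 0 < g <= 1 -> 0 < r <= 1 -> g <= C * r ->
  K * r <= 1 / 2 -> 2 * m.+2%:R * r <= delta / 4 ->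
  odds_drift_bound delta m B c K g r X
    <= (1 - kappa * g) * ((1 - X) / (X + K * r)) ^+ m.+2.
Proof.
move=> DE delta0 c0 B1 C1 K0 hK1 hK2 k1 k2 /andP[X0 X1] /andP[g0 g1] /andP[r0 r1] gr Kr1 nr.
have n1 : 1 <= m.+2%:R :> R by rewrite ler1n.
have B0 : 0 <= B by lra.
have b0 : 0 <= m.+2%:R ^+ 2 * (2 + B) ^+ m by rewrite mulr_ge0 ?sqr_ge0// exprn_ge0//; lra.
have D0 : 0 <= D by rewrite DE mulr_ge0 ?sqr_ge0// mulr_ge0// mulr_ge0// exprn_ge0.
move: DE nr hK1 hK2 b0 n1; rewrite /odds_drift_bound (exprMn m (2 + B)) (mulrA (_ ^+ 2)).
move: (m.+2%:R) => n; move bE : (n ^+ 2 * (2 + B) ^+ m) => b DE nr hK1 hK2 b0 n1.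
have Kr0 : 0 < K * r by exact: mulr_gt0.
have y2 : 1 / 2 <= 1 - X by clear - X1; lra.
have Xy : X <= 1 - X by clear - X1; lra.
have w12 : 1 <= 1 + K * r <= 2 by clear - Kr0 Kr1; lra.
have u0 : 0 < X + K * r by clear - X0 Kr0; lra.
have u1 : X + K * r <= 1 by clear - X1 Kr1; lra.
move: y2 Xy w12 u0 u1; move: (1 + K * r) => w.
move uE : (X + K * r) => u; move: (1 - X) => y y2 Xy w12 u0 u1.
have uv : u * u^-1 = 1 by rewrite divff// gt_eqF.
have v0 : 0 < u^-1 by rewrite invr_gt0.
have v1 : 1 <= u^-1 by rewrite invf_ge1.
move: uv v0 v1; move: (u^-1) => v uv v0 v1; have v0' := ltW v0.
have vs : v <= 2 * (y * v).
  have : 1 / 2 * v <= y * v by exact: ler_wpM2r.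
  by clear; lra.
have gs : g <= 2 * (y * v) by clear - g1 v1 vs; lra.
have gv0 : 0 <= g * v by rewrite mulr_ge0// ltW.
(* The effect of [K]: v <= 1 / (K r) and g <= C r, so that the ratio g v of second to first order
   terms is at most C / K. *)
have gvK : g * v * K <= C.
  apply: (@le_trans _ _ (C * r * v * K)).
    by apply: ler_wpM2r; [exact: ltW|exact: ler_wpM2r].
  rewrite (_ : C * r * v * K = C * (K * r * v)); last by ring.
  rewrite ler_piMr//; first by clear - C1; lra.
  by rewrite -uv; apply: ler_wpM2r => //; clear - X0 uE; lra.
have nBD : 0 <= 4 * n * B + D.
  by rewrite addr_ge0// mulr_ge0//; clear - n1; lra.
have gvKD := ler_wpM2l nBD gvK.
have e1 : (4 * n * B + D) * (g * v) <= delta / 4.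
  by rewrite -(ler_pM2r K0) [leRHS]mulrC; apply: (le_trans _ hK1); rewrite -(mulrA (4 * n * B + D)).
have e2 : (4 * n * B + D) * (g * v) <= c / 8.
  by rewrite -(ler_pM2r K0) [leRHS]mulrC; apply: (le_trans _ hK2); rewrite -(mulrA (4 * n * B + D)).
have y0 : 0 <= y by clear - y2; lra.
have Q0 : 0 <= X * y + r ^+ 2 by rewrite addr_ge0 ?sqr_ge0 ?mulr_ge0.
have w02 : 0 <= w <= 2 by clear - w12; case/andP: w12 => ? ?; apply/andP; split; lra.
have h1 := second_order_far m B b0 Q0 (ltW g0) v0' gs vs w02.
have h2 := drift_far delta0 c0 n1 w12 B0 gv0 D0 e1 e2 X0 Xy y2 r0 nr r1 k1 k2.
have Z0 : 0 <= (y * v) ^+ m.+1 * (g * v ^+ 2).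
  by apply: mulr_ge0; [exact/exprn_ge0/mulr_ge0|rewrite mulr_ge0 ?sqr_ge0// ltW].
have h3 := ler_wpM2l Z0 h2.
(* As u v = 1, the prefactor s^(m+1) g v^2 turns y (X + K r) into g s^(m+2). *)
have E : (y * v) ^+ m.+1 * (g * v ^+ 2) * (kappa * (y * (X + K * r)))
    = kappa * g * (y * v) ^+ m.+2.
  rewrite uE (exprS _ m.+1) -[RHS]mulr1 -uv; ring.
rewrite E in h3; rewrite -DE in h1.
move: h1 h3; move: ((y * v) ^+ m.+2) ((y * v) ^+ m.+1) ((y * v + g) ^+ m) => s2 s1 sm.
by clear; lra.
Qed.

Lemma odds_drift_bound_near m (B C c delta K g r X : R) :
  0 < delta -> 0 < c -> 1 <= B -> 1 <= C -> 0 < K ->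
  1 / 2 <= X <= 1 -> 0 < g <= 1 -> 0 < r <= 1 -> g <= C * r -> K * r <= 1 / 2 ->
  let s := (1 - X) / (X + K * r) in
  let D := 2 * m.+2%:R * (1 + 24 * B * C)
    + m.+2%:R ^+ 2 * (2 + B) ^+ m * 256 * B ^+ 2 * C ^+ m.+1 in
  is_true (odds_drift_bound delta m B c K g r X
    <= (1 - delta / 2 * g) * s ^+ m.+2 + g * (D * (r * (s + r) ^+ m.+1))).
Proof.
move=> delta0 c0 B1 C1 K0 /andP[X0 X1] /andP[g0 g1] /andP[r0 r1] gr Kr1 s D; rewrite /s /D {s D}.
have n1 : 1 <= m.+2%:R :> R by rewrite ler1n.
have B0 : 0 <= B by lra.
have b0 : 0 <= m.+2%:R ^+ 2 * (2 + B) ^+ m by rewrite mulr_ge0 ?sqr_ge0// exprn_ge0//; lra.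
move: b0 n1; rewrite /odds_drift_bound (exprMn m (2 + B)) (mulrA (_ ^+ 2)).
move: (m.+2%:R) => n; move: (n ^+ 2 * (2 + B) ^+ m) => b b0 n1.
have Kr0 : 0 < K * r by exact: mulr_gt0.
have y1 : 1 - X <= 1 / 2 by clear - X0; lra.
have y0 : 0 <= 1 - X by clear - X1; lra.
have w12 : 1 <= 1 + K * r <= 2 by clear - Kr0 Kr1; lra.
have u0 : 0 < X + K * r by clear - X0 Kr0; lra.
have uX : X <= X + K * r by clear - Kr0; lra.
have u2X : X + K * r <= 2 * X by clear - X0 Kr1; lra.
have u32 : X + K * r <= 3 / 2 by clear - X1 Kr1; lra.
move: y0 y1 w12 u0 uX u2X u32; move: (1 + K * r) => w.
move: (X + K * r) => u; move: (1 - X) => y y0 y1 w12 u0 uX u2X u32.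
have uv : u * u^-1 = 1 by rewrite divff// gt_eqF.
have v0 : 0 < u^-1 by rewrite invr_gt0.
have v2 : u^-1 <= 2 by rewrite -(ler_pM2l u0) uv; clear - X0 uX; lra.
move: uv v0 v2; move: (u^-1) => v uv v0 v2; have v0' := ltW v0.
have v02 : 0 <= v <= 2 by apply/andP.
have Xv : 1 / 2 <= X * v <= 1.
  have := ler_wpM2r v0' uX; have := ler_wpM2r v0' u2X; rewrite uv.
  by clear => ? ?; apply/andP; split; lra.
have s0 : 0 <= y * v by exact: mulr_ge0.
have r0' := ltW r0; have g0' := ltW g0.
have ys : y <= 3 / 2 * (y * v).
  have := ler_wpM2r s0 u32; rewrite mulrCA uv mulr1; by [].
have Q0 : 0 <= X * y + r ^+ 2 by rewrite addr_ge0 ?sqr_ge0// mulr_ge0//; clear - X0; lra.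
have Qs : X * y + r ^+ 2 <= 2 * (y * v + r).
  have : X * y <= y by rewrite ler_piMl.
  have : r ^+ 2 <= r by rewrite expr2 ler_piMr.
  by clear - ys s0 r0'; lra.
have w02 : 0 <= w <= 2 by clear - w12; case/andP: w12 => ? ?; apply/andP; split; lra.
have C0 : 0 <= C by clear - C1; lra.
have h1 := second_order_near m B b0 Q0 g0' v02 s0 r0' C1 gr w02 Qs.
have h2 := drift_near delta0 c0 n1 w12 B1 g0' gr C0 v02 Xv X1 y0 y1 r0 r1.
have Z0 : 0 <= (y * v) ^+ m.+1 by exact: exprn_ge0.
have ZY : (y * v) ^+ m.+1 <= (y * v + r) ^+ m.+1.
  by apply: lerXn2r; rewrite ?nnegrE ?addr_ge0//; clear - r0'; lra.
have h3 := ler_wpM2l (mulr_ge0 Z0 g0') h2.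
have D0 : 0 <= g * (2 * n * (1 + 24 * B * C) * r).
  have BC : 0 <= B * C by exact: mulr_ge0.
  apply: mulr_ge0 => //; apply: mulr_ge0 => //.
  by apply: mulr_ge0; [clear - n1; lra|clear - BC; lra].
have h4 := ler_wpM2l D0 ZY.
rewrite (exprS _ m.+1).
move: h1 h3 h4; move: ((y * v) ^+ m.+1) ((y * v + r) ^+ m.+1) ((y * v + g) ^+ m) (C ^+ m.+1) => s2 s1 sm Cm.
by clear; lra.
Qed.

(** The constants are chosen before g, r and X: [K] large for the far regime, then [kappa] small
    relative to 1 / K, then [r0]. *)
Lemma odds_drift_bound_contracts m (B C c delta : R) :
  0 < delta -> 0 < c -> 1 <= B -> 1 <= C ->
  exists K kappa D r0, [/\ 0 < K, 0 < kappa, 0 <= D, 0 < r0 &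
    forall g r X, 0 <= X <= 1 -> 0 < g <= 1 -> 0 < r <= r0 -> g <= C * r ->
    [/\ r <= 1, K * r <= 1 & odds_drift_bound delta m B c K g r X
      <= (1 - kappa * g) * ((1 - X) / (X + K * r)) ^+ m.+2 + g * (D * r ^+ m.+2)]].
Proof.
move=> delta0 c0 B1 C1.
pose D := m.+2%:R ^+ 2 * (2 + B) ^+ m * 3 ^+ m * 16 * B ^+ 2.
pose E := (4 * m.+2%:R * B + D) * C.
pose F := 2 * m.+2%:R * (1 + 24 * B * C)
    + m.+2%:R ^+ 2 * (2 + B) ^+ m * 256 * B ^+ 2 * C ^+ m.+1.
have B0 : 0 <= B by lra.
have C0 : 0 <= C by lra.
have n0 : 0 < m.+2%:R :> R by [].
have b0 : 0 <= m.+2%:R ^+ 2 * (2 + B) ^+ m by rewrite mulr_ge0 ?sqr_ge0// exprn_ge0//; lra.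
have D0 : 0 <= D by rewrite /D mulr_ge0 ?sqr_ge0// mulr_ge0// mulr_ge0// exprn_ge0.
have nB : 0 < m.+2%:R * B by rewrite mulr_gt0//; lra.
have E0 : 0 < E by rewrite /E mulr_gt0//; [clear - nB D0; lra|lra].
have F0 : 0 <= F.
  rewrite /F; apply: addr_ge0.
    have := mulr_ge0 B0 C0 => BC; apply: mulr_ge0; last by clear - BC; lra.
    by rewrite mulr_ge0// ltW.
  apply: mulr_ge0; last exact: exprn_ge0.
  apply: mulr_ge0; last exact: sqr_ge0.
  by apply: mulr_ge0; [exact: b0|clear; lra].
have delta4 : 0 < delta / 4 by lra.
(* Half of the decay delta / 2 of the near regime is given up to absorb its cross term. *)
have [G G0 hG] := young_power m F0 delta4.
pose K := E * (4 / delta + 8 / c).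
have K0 : 0 < K by rewrite mulr_gt0// addr_gt0// divr_gt0.
have hK1 : E <= K * (delta / 4).
  have -> : K * (delta / 4) = E * (1 + 2 * delta / c) by rewrite /K; field; lra.
  have : 0 <= 2 * delta / c by rewrite divr_ge0 ?ltW//; lra.
  by move=> h; apply: ler_peMr; [exact: ltW|clear - h; lra].
have hK2 : E <= K * (c / 8).
  have -> : K * (c / 8) = E * (1 + c / delta / 2) by rewrite /K; field; lra.
  have : 0 <= c / delta / 2 by rewrite !divr_ge0 ?ltW//; lra.
  by move=> h; apply: ler_peMr; [exact: ltW|clear - h; lra].
pose kappa := Num.min (delta / 4) (c / 4 / K).
have k0 : 0 < kappa by rewrite lt_min delta4 !divr_gt0.
have k1 : kappa <= delta / 4 by rewrite ge_min lexx.
have k2 : kappa * K <= c / 4 by rewrite -ler_pdivlMr// ge_min lexx orbT.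
(* Each summand enforces one condition for r <= 1 / H: r <= 1, K r <= 1/2 and 2 (m + 2) r <= delta /
   4. *)
pose H := 1 + 2 * K + 8 * m.+2%:R / delta.
have nd : 0 < 8 * m.+2%:R / delta by rewrite divr_gt0// mulr_gt0.
have H0 : 0 < H by rewrite /H; clear - K0 nd; lra.
exists K, kappa, G, H^-1; split => //; first by rewrite invr_gt0.
move=> g r X /andP[X0 X1] /andP[g0 g1] /andP[r0 rH] gC.
have rH1 : r * H <= 1 by rewrite -ler_pdivlMr// mul1r.
have r0' := ltW r0.
have rK : 0 < r * K by rewrite mulr_gt0.
have rnd : 0 < r * (8 * m.+2%:R / delta) by rewrite mulr_gt0.
have rE : r + 2 * (r * K) + r * (8 * m.+2%:R / delta) <= 1.
  apply: (le_trans _ rH1); rewrite le_eqVlt /H; apply/orP; left; apply/eqP; ring.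
have r1 : r <= 1 by clear - rE rK rnd; lra.
have Kr : K * r <= 1 / 2 by rewrite mulrC; clear - rE rnd r0; lra.
have nr : 2 * m.+2%:R * r <= delta / 4.
  have : r * (8 * m.+2%:R / delta) * delta <= 1 * delta.
    by apply: ler_wpM2r; [exact: ltW|clear - rE rK r0; lra].
  rewrite mul1r mulrA divfK ?gt_eqF//; clear; lra.
split => //; first by clear - Kr; lra.
have s0 : 0 <= (1 - X) / (X + K * r).
  by rewrite divr_ge0//; [clear - X1; lra|rewrite addr_ge0// mulr_ge0// ltW].
have [Xh|/ltW Xh] := leP X (1 / 2).
  apply: (@le_trans _ _ ((1 - kappa * g) * ((1 - X) / (X + K * r)) ^+ m.+2)); last first.
    by rewrite lerDl mulr_ge0 ?(ltW g0)// mulr_ge0// exprn_ge0.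
  by apply: (@odds_drift_bound_far m B C D) => //; rewrite ?X0 ?g0 ?r0//; clear - k1 delta0; lra.
have X12 : 1 / 2 <= X <= 1 by apply/andP.
have g01 : 0 < g <= 1 by apply/andP.
have r01 : 0 < r <= 1 by apply/andP.
apply: le_trans (odds_drift_bound_near m delta0 c0 B1 C1 K0 X12 g01 r01 gC Kr) _.
rewrite -/F; have := hG _ _ s0 r0' => /(ler_wpM2l (ltW g0)).
have := exprn_ge0 m.+2 s0; move: (_ ^+ m.+2) => s2 s20.
have := ler_wpM2r (mulr_ge0 (ltW g0) s20) k1.
clear; move: (F * _) (r ^+ _) => a1 a2; lra.
Qed.

End OddsRecursion.

(** * Moments of the best arm *)

Section PowerSequences.
Context (R : realType).
Implicit Types (n N : nat) (a c e t M : R).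

(** Bernoulli's inequality (1 + 1/n)^(-t) >= 1 - t/n, from ln (1 + x) <= x and exp x >= 1 + x. *)
Lemma powR_natS_ge t n : 0 <= t -> (0 < n)%N ->
  (1 - t / n%:R) * n%:R `^ (- t) <= n.+1%:R `^ (- t).
Proof.
move=> t0 n0; have n0' : 0 < n%:R :> R by rewrite ltr0n.
have -> : n.+1%:R = n%:R * (1 + n%:R^-1) :> R.
  by rewrite mulrDr mulr1 divff ?gt_eqF// natr1.
have i0 : 0 <= n%:R^-1 :> R by rewrite invr_ge0 ltW.
have i1 : 0 < 1 + n%:R^-1 :> R by rewrite ltr_wpDr.
rewrite powRM ?(ltW n0') ?(ltW i1)// mulrC ler_wpM2l ?powR_ge0//.
rewrite /powR gt_eqF//.
apply: (@le_trans _ _ (expR (- (t / n%:R)))); first exact: expR_ge1Dx.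
rewrite ler_expR mulNr lerN2 ler_wpM2l//.
by apply: le_ln1Dx; apply: lt_le_trans i0; rewrite oppr_lt0.
Qed.

Lemma powR_eventually_ge t M : 0 < t -> exists N, forall n, (N <= n)%N -> M <= n%:R `^ t.
Proof.
move=> t0; pose M' := Num.max M 1; have M'0 : 0 < M' by rewrite lt_max ltr01 orbT.
exists (Num.truncn (M' `^ t^-1)).+1 => n Nn.
apply: (@le_trans _ _ M'); first by rewrite le_max lexx.
have -> : M' = (M' `^ t^-1) `^ t by rewrite -powRrM mulVf ?gt_eqF// powRr1// ltW.
apply: ge0_ler_powR; rewrite ?nnegrE ?powR_ge0 ?(ltW t0)//.
apply: ltW; apply: (lt_le_trans (truncnS_gt (M' `^ t^-1))).
by rewrite ler_nat.
Qed.

Lemma powR_eventually_le t e : 0 < t -> 0 < e ->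
  exists N, forall n, (N <= n)%N -> n%:R `^ (- t) <= e.
Proof.
move=> t0 e0; have [N hN] := powR_eventually_ge e^-1 t0.
exists N => n /hN h; rewrite powRN -[e]invrK lef_pV2 ?posrE ?invr_gt0//.
by apply: lt_le_trans h; rewrite invr_gt0.
Qed.

(** For a < 1 the relative decay 1/n of a power sequence is negligible against steps of order
    n^(-a). *)
Lemma inv_eventually_le a c e : a < 1 -> 0 <= c -> 0 < e ->
  exists N, forall n, (N <= n)%N -> c / n%:R <= e * n.+1%:R `^ (- a).
Proof.
move=> a1 c0 e0; have b0 : 0 < 1 - a by rewrite subr_gt0.
have [N hN] := powR_eventually_ge (2 * c / e) b0.
exists (maxn N 1) => n; rewrite geq_max => /andP[Nn n0].
have n0' : 0 < n%:R :> R by rewrite ltr0n.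
have n1 : 0 < n.+1%:R :> R by rewrite ltr0n.
have n2 : n.+1%:R <= 2 * n%:R :> R by rewrite -natrM ler_nat mul2n -addnn -addn1 leq_add2l.
have := hN _ (leqW Nn); rewrite powRD; last by rewrite gt_eqF// implybT.
rewrite powRr1 ?ler0n// ler_pdivrMr// => h.
rewrite ler_pdivrMr//; apply: (@le_trans _ _ (e * n.+1%:R `^ (- a) * (n.+1%:R / 2))).
  by clear - h; lra.
apply: ler_wpM2l; first by rewrite mulr_ge0 ?powR_ge0// ltW.
by clear - n2; lra.
Qed.

Lemma power_step_exp c a k n : power_step c a n ^+ k = c ^+ k * n%:R `^ (- (a * k%:R)).
Proof.
by rewrite /power_step exprMn -(powR_mulrn k (powR_ge0 n%:R (- a))) -powRrM mulNr.
Qed.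

Lemma power_step_ge0 c a n : 0 <= c -> 0 <= power_step c a n.
Proof. by move=> c0; rewrite mulr_ge0 ?powR_ge0. Qed.

Lemma power_step_gt0 c a n : 0 < c -> 0 < power_step c a n.+1.
Proof. by move=> c0; rewrite mulr_gt0 ?powR_gt0. Qed.

Lemma power_step_le c a n : 0 <= c -> 0 <= a -> power_step c a n.+1 <= c.
Proof.
move=> c0 a0; rewrite ler_piMr// powRN invf_le1 ?powR_gt0//.
by apply: (@le_trans _ _ (n.+1%:R `^ 0)); [rewrite powRr0|rewrite ler_powR// ler1n].
Qed.

Lemma power_step_nincr c a n : (0 < n)%N -> 0 <= c -> 0 <= a ->
  power_step c a n.+1 <= power_step c a n.
Proof.
move=> n0 c0 a0; apply: ler_wpM2l => //; rewrite !powRN.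
rewrite lef_pV2 ?posrE ?powR_gt0 ?ltr0n//.
by apply: ge0_ler_powR; rewrite ?nnegrE ?ler_nat.
Qed.

Lemma power_step01 c a n : 0 < c < 1 -> 0 <= a -> 0 <= power_step c a n.+1 <= (1 : R).
Proof.
move=> /andP[c0 c1] a0; rewrite power_step_ge0 ?(ltW c0)//=.
by apply: le_trans (ltW c1); rewrite power_step_le// ltW.
Qed.

Lemma natr_powR_nincr n (a b : R) : (0 < n)%N -> a <= b ->
  n%:R `^ (- b) <= n%:R `^ (- a) :> R.
Proof. by move=> n0 ab; rewrite ler_powR ?ler1n// lerN2. Qed.

(** The same comparison with an explicit gain n^(-e); the 2 pays for passing from n to n + 1. *)
Lemma inv_le_powR n a e : (0 < n)%N -> 0 <= e -> e <= 1 - a ->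
  n%:R^-1 <= 2 * (n.+1%:R `^ (- a) * n%:R `^ (- e)) :> R.
Proof.
move=> n0 e0 ea; have n0' : 0 < n%:R :> R by rewrite ltr0n.
have n1 : 0 < n.+1%:R :> R by rewrite ltr0n.
have n2 : n.+1%:R <= 2 * n%:R :> R by rewrite -natrM ler_nat mul2n -addnn -addn1 leq_add2l.
apply: (@le_trans _ _ (2 * n.+1%:R^-1)).
  by rewrite ler_pdivlMr// mulrC ler_pdivrMr.
apply: ler_wpM2l => //.
have -> : n.+1%:R^-1 = n.+1%:R `^ (- a) * n.+1%:R `^ (- (1 - a)) :> R.
  rewrite -powRD; last by apply/implyP => _; rewrite gt_eqF.
  by rewrite (_ : - a + - (1 - a) = -1); [rewrite powRN powRr1// ltW|ring].
apply: ler_wpM2l; first exact: powR_ge0.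
apply: le_trans (natr_powR_nincr _ ea) _ => //.
rewrite !powRN lef_pV2 ?posrE ?powR_gt0//.
by apply: ge0_ler_powR; rewrite ?nnegrE ?ler_nat.
Qed.

End PowerSequences.

Section Recursion.
Context (R : realFieldType).

(** A discrete Gronwall lemma: [v] loses at most half of the contraction per step, so e <= M v
    propagates once the other half, M kappa / 2, covers [C]. The constant M also covers the initial
    ratio. *)
Lemma recursion_rate (e v g : nat -> R) (kappa C : R) (N : nat) :
  0 < kappa -> 0 <= C -> (forall n, (N <= n)%N -> 0 < v n) ->
  (forall n, (N <= n)%N -> 0 <= kappa * g n <= 1) ->
  (forall n, (N <= n)%N -> (1 - kappa / 2 * g n) * v n <= v n.+1) ->
  (forall n, (N <= n)%N -> e n.+1 <= (1 - kappa * g n) * e n + C * g n * v n) ->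
  exists2 M, 0 <= M & forall n, (N <= n)%N -> e n <= M * v n.
Proof.
move=> k0 C0 v0 g01 hv he.
pose M := Num.max (Num.max 0 (e N / v N)) (2 * C / kappa).
have M0 : 0 <= M by rewrite !le_max lexx.
have MC : C <= M * (kappa / 2).
  have : 2 * C / kappa <= M by rewrite le_max lexx orbT.
  by rewrite ler_pdivrMr//; lra.
exists M => // n; elim: n => [|n IH].
  by rewrite leqn0 => /eqP N0; rewrite -ler_pdivrMr ?v0 ?N0// !le_max N0 lexx !orbT.
rewrite leq_eqVlt => /orP[/eqP <-|].
  by rewrite -ler_pdivrMr ?v0// !le_max lexx !orbT.
rewrite ltnS => Nn; apply: le_trans (he _ Nn) _.
have /andP[kg0 kg1] := g01 _ Nn; have vn0 := v0 _ Nn.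
have gn0 : 0 <= g n by rewrite -(pmulr_rge0 _ k0).
have h1 : (1 - kappa * g n) * e n <= (1 - kappa * g n) * (M * v n).
  by apply: ler_wpM2l; [rewrite subr_ge0|exact: IH].
have h2 := ler_wpM2r (mulr_ge0 gn0 (ltW vn0)) MC.
have h3 := ler_wpM2l M0 (hv _ Nn).
by clear - h1 h2 h3; lra.
Qed.

(** The Lyapunov function depends on time through r. As r / (X + K r) is nondecreasing in r,
    lowering r to r' inflates the odds by at most r / r'. The resulting factor 1 / (1 - t) costs
    half of the contraction, since (1 - kg / 2)^2 >= 1 - kg. *)
Lemma odds_power_shift (m : nat) (kg t K X y r r' : R) :
  0 <= y -> 0 <= X -> 0 < K -> 0 < r' -> r' <= r ->
  (1 - t) * r ^+ m <= r' ^+ m -> 0 <= t -> t <= kg / 2 -> 0 <= kg <= 1 ->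
  (1 - kg) * (y / (X + K * r')) ^+ m <= (1 - kg / 2) * (y / (X + K * r)) ^+ m.
Proof.
move=> y0 X0 K0 r'0 rr tr t0 tk /andP[k0 k1].
have r0 : 0 < r := lt_le_trans r'0 rr.
have Kr : 0 < K * r by exact: mulr_gt0.
have Kr' : 0 < K * r' by exact: mulr_gt0.
have u0 : 0 < X + K * r by lra.
have u'0 : 0 < X + K * r' by lra.
have s0 : 0 <= y / (X + K * r') by rewrite divr_ge0// ltW.
have s1 : 0 <= y / (X + K * r) by rewrite divr_ge0// ltW.
have ss : y / (X + K * r') * r' <= y / (X + K * r) * r.
  rewrite mulrAC ler_pdivrMr//.
  have -> : y / (X + K * r) * r * (X + K * r') = y * (r * (X + K * r')) / (X + K * r) by ring.
  rewrite ler_pdivlMr// -mulrA ler_wpM2l//.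
  have := ler_wpM2l X0 rr; lra.
have : (y / (X + K * r') * r') ^+ m <= (y / (X + K * r) * r) ^+ m.
  by apply: lerXn2r => //; rewrite nnegrE mulr_ge0// ltW.
rewrite (exprMn m (y / (X + K * r'))) (exprMn m (y / (X + K * r))); have r0m : 0 < r ^+ m by rewrite exprn_gt0.
have := exprn_ge0 m s0; have := exprn_ge0 m s1.
move: ((y / (X + K * r')) ^+ m) ((y / (X + K * r)) ^+ m) => S' S S0 S'0 h.
rewrite -(ler_pM2r r0m).
have h1 := ler_wpM2l S'0 tr.
have h2 : (1 - kg / 2) * (S' * r' ^+ m) <= (1 - kg / 2) * (S * r ^+ m).
  by apply: ler_wpM2l => //; lra.
have h3 : (1 - kg / 2) * (S' * ((1 - t) * r ^+ m)) <= (1 - kg / 2) * (S' * r' ^+ m).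
  by apply: ler_wpM2l => //; lra.
have S'r : 0 <= S' * r ^+ m by rewrite mulr_ge0// ltW.
have kt : 1 - kg <= (1 - kg / 2) * (1 - t).
  have := mulr_ge0 k0 t0; lra.
have h4 := ler_wpM2r S'r kt.
move: h2 h3 h4; clear; lra.
Qed.

End Recursion.

Section Evolution.
Context (R : realType) (d : nat) (hd : (1 < d)%N)
    (p : 'I_d -> R) (hp01 : forall j, 0 < p j < 1)
    (sigma : R) (hsigma : 0 < sigma <= 1)
    (gamma rho : nat -> R)
    (hgamma : forall n, 0 <= gamma n.+1 <= 1) (hrho : forall n, 0 <= rho n.+1 <= 1).
Implicit Types (f h : 'rV[R]_d -> R) (x : 'rV[R]_d).

Local Notation E := (evolve p sigma gamma rho).

Lemma evolve_le m k f h x : simplex x -> (forall z, simplex z -> f z <= h z) ->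
  E m k f x <= E m k h x.
Proof.
move=> hx fh; elim: k m x hx => [|k IH] m x hx /=; first exact: fh.
apply: ler_sum => j _; apply: ler_wpM2l; first by apply: round_weight_ge0 hx.1.
by apply: IH; exact: simplex_next.
Qed.

Lemma evolve_lin m k a b f h x :
  E m k (fun z => a * f z + b * h z) x = a * E m k f x + b * E m k h x.
Proof.
elim: k m x => [//|k IH] m x /=.
rewrite /transition !mulr_sumr -big_split /=; apply: eq_bigr => j _.
by rewrite IH; ring.
Qed.

Lemma evolve_cst m k c x : simplex x -> E m k (fun=> c) x = c.
Proof.
move=> hx; elim: k m x hx => [//|k IH] m x hx /=.
rewrite /transition -[RHS]mul1r -(sum_round_weight p sigma hx) mulr_suml.
by apply: eq_bigr => j _; rewrite IH//; exact: simplex_next.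
Qed.

Lemma evolve_scale m k a f x : E m k (fun z => a * f z) x = a * E m k f x.
Proof.
elim: k m x => [//|k IH] m x /=.
by rewrite /transition mulr_sumr; apply: eq_bigr => j _; rewrite IH; ring.
Qed.

Lemma evolveS_le k f h x : simplex x ->
  (forall z, simplex z -> transition p sigma (gamma k.+1) (rho k.+1) f z <= h z) ->
  E 0 k.+1 f x <= E 0 k h x.
Proof. by move=> hx fh; rewrite evolve_last add0n; exact: evolve_le. Qed.

End Evolution.

Section BestArmMoments.
Context (R : realType) (d : nat) (hd : (1 < d)%N)
    (p : 'I_d -> R) (hp01 : forall j, 0 < p j < 1)
    (sigma : R) (hsigma : 0 < sigma <= 1)
    (o : 'I_d) (delta : R) (hdelta : 0 < delta)
    (hgap : forall i, i != o -> p i <= p o - delta)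
    (alpha beta gamma1 rho1 : R)
    (halpha : 0 < alpha) (halpha1 : alpha < 1) (hbeta : 0 < beta) (hab : beta <= alpha)
    (hgamma1 : 0 < gamma1 < 1) (hrho1 : 0 < rho1 < 1)
    (x0 : 'rV[R]_d) (hx0 : simplex x0).

Let gamma := power_step gamma1 alpha.
Let rho := power_step rho1 beta.
Local Notation E := (evolve p sigma gamma rho 0).

Lemma gamma_le_rho n : gamma n.+1 <= gamma1 / rho1 * rho n.+1.
Proof.
have /andP[r0 _] := hrho1; have /andP[g0 _] := hgamma1.
rewrite /gamma /rho /power_step mulrA divfK ?gt_eqF// ler_wpM2l ?(ltW g0)//.
by rewrite ler_powR ?ler1n// lerN2.
Qed.

Lemma best_arm_moment m : exists C N, 0 <= C /\ forall n, (N <= n)%N ->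
  E n (fun x => (1 - x 0 o) ^+ m.+2) x0 <= C * rho n ^+ m.+2.
Proof.
have /andP[r10 r11] := hrho1; have /andP[g10 g11] := hgamma1.
pose C1 := Num.max 1 (gamma1 / rho1).
have C11 : 1 <= C1 by rewrite le_max lexx.
have gC n : gamma n.+1 <= C1 * rho n.+1.
  apply: le_trans (gamma_le_rho n) _; apply: ler_wpM2r; first by rewrite power_step_ge0// ltW.
  by rewrite le_max lexx orbT.
have B1 : 1 <= (1 - gamma1)^-1 by rewrite invf_ge1; lra.
have dg := natrB1_ge1 R hd.
have c0 : 0 < (1 - sigma * p o) / (d%:R - 1) ^+ 2.
  by rewrite divr_gt0 ?(failure_prob_gt0 hp01 hsigma)// exprn_gt0//; lra.
have [K [kappa [D [r0 [K0 k0 D0 r00 hcontr]]]]] := odds_drift_bound_contracts m hdelta c0 B1 C11.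
pose t := beta * m.+2%:R.
have t0 : 0 <= t by rewrite mulr_ge0// ltW.
have k4 : 0 < kappa / 4 * gamma1 by rewrite mulr_gt0//; lra.
have [N1 hN1] := inv_eventually_le halpha1 t0 k4.
have rr0 : 0 < r0 / rho1 by rewrite divr_gt0.
have [N2 hN2] := powR_eventually_le hbeta rr0.
have kg0 : 0 < (kappa * gamma1)^-1 by rewrite invr_gt0 mulr_gt0.
have [N3 hN3] := powR_eventually_le halpha kg0.
(* The successor excludes n = 0, where [rho] vanishes. *)
pose N := (maxn N1 (maxn N2 N3)).+1.
pose e n := E n (fun x => odds o K (rho n) x ^+ m.+2) x0.
pose v n := rho n ^+ m.+2.
pose g n := gamma n.+1.
have g0 n : 0 < g n by exact: power_step_gt0.
have rho0 n : (N <= n)%N -> 0 < rho n by case: n => // n _; exact: power_step_gt0.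
(* Budget: changing rho_{n+1} into rho_n leaves kappa / 2 of the contraction, half of which must
   dominate the relative decay t / n of [v]; hence kappa / 4. *)
have hN n : (N <= n)%N -> [/\ t / n%:R <= kappa / 4 * g n, rho n.+1 <= r0 & kappa * g n <= 1].
  rewrite /N gtn_max gtn_max => /and3P[/ltnW n1 /ltnW n2 /ltnW n3]; split.
  - by rewrite /g /gamma /power_step mulrA; exact: hN1.
  - rewrite /rho /power_step mulrC -ler_pdivlMr//; apply: hN2; exact: leqW.
  - rewrite /g /gamma /power_step mulrA -ler_pdivlMl ?mulr_gt0// mulr1; apply: hN3; exact: leqW.
have hv n : (N <= n)%N -> (1 - t / n%:R) * v n <= v n.+1.
  move=> Nn; rewrite /v /rho !power_step_exp mulrCA ler_wpM2l ?exprn_ge0 ?(ltW r10)//.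
  by apply: powR_natS_ge => //; exact: leq_trans Nn.
have v0 n : (N <= n)%N -> 0 < v n by move=> /rho0 h; rewrite exprn_gt0.
have he n : (N <= n)%N -> e n.+1 <= (1 - kappa / 2 * g n) * e n + D * g n * v n.
  move=> Nn; have [h1 h2 h3] := hN _ Nn; have vn := v0 _ Nn; have hvn := hv _ Nn.
  have rn0 := rho0 _ Nn; have rn10 : 0 < rho n.+1 := power_step_gt0 beta n r10.
  have g01 : 0 < g n <= 1 by rewrite g0; case/andP: (power_step01 n hgamma1 (ltW halpha)).
  have gg1 : 0 < g n <= gamma1 by rewrite g0 power_step_le// ltW.
  have r01 : 0 < rho n.+1 <= 1 by rewrite rn10; case/andP: (power_step01 n hrho1 (ltW hbeta)).
  have r0r : 0 < rho n.+1 <= r0 by rewrite rn10.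
  have vn1 : v n.+1 <= v n.
    rewrite lerXn2r ?nnegrE ?(ltW rn0) ?(ltW rn10)//.
    by apply: power_step_nincr; [exact: leq_trans Nn|exact: ltW..].
  rewrite /e; apply: le_trans (evolveS_le (h := fun x => (1 - kappa / 2 * g n) * odds o K (rho n) x ^+ m.+2
      + D * g n * v n * 1) _ _ _ _ _ _ _) _ => //.
  - by move=> k; exact: power_step01 (ltW halpha).
  - by move=> k; exact: power_step01 (ltW hbeta).
  (* The contraction has rho_{n+1} in the odds before and after the round; [odds_power_shift] then
     returns to rho_n. *)
  - move=> x hx; have X01 : 0 <= x 0 o <= 1 by rewrite hx.1 simplex_le1.
    have [r1 Kr1 h4] := hcontr _ _ _ X01 g01 r0r (gC n).
    apply: le_trans (odds_moment_expansion hd hp01 hsigma hdelta hgap m g11 hx gg1 r01 K0 Kr1) _.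
    apply: (le_trans h4) => {h4}; rewrite mulr1; apply: lerD; last first.
      by rewrite mulrA [g n * D]mulrC ler_wpM2l// mulr_ge0// ltW.
    have rr : rho n.+1 <= rho n.
      by apply: power_step_nincr; [exact: leq_trans Nn|exact: ltW..].
    have y0 : 0 <= 1 - x 0 o by rewrite subr_ge0; case/andP: X01.
    have tn : 0 <= t / n%:R by rewrite divr_ge0.
    have -> : kappa / 2 * g n = kappa * g n / 2 by ring.
    by apply: (odds_power_shift y0 (hx.1 o) K0 rn10 rr (hv _ Nn)) => //; lra.
  rewrite (evolve_lin p sigma gamma rho 0 n _ _ (fun x => odds o K (rho n) x ^+ m.+2) (fun=> 1)).
  rewrite (evolve_cst hd) ?mulr1//.
  - by move=> k; exact: power_step01 (ltW halpha).
  - by move=> k; exact: power_step01 (ltW hbeta).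
have [M M0 hM] : exists2 M, 0 <= M & forall n, (N <= n)%N -> e n <= M * v n.
  have k2 : 0 < kappa / 2 by lra.
  apply: (recursion_rate k2 D0 v0 _ _ he).
  - move=> n /hN[_ _ h]; have := mulr_ge0 (ltW k2) (ltW (g0 n)).
    by have := mulr_ge0 (ltW k0) (ltW (g0 n)); lra.
  - move=> n Nn; apply: le_trans (hv _ Nn); rewrite ler_wpM2r ?(ltW (v0 _ Nn))//.
    by have [h _ _] := hN _ Nn; lra.
exists ((1 + K * r0) ^+ m.+2 * M), N.+1.
split; first by rewrite mulr_ge0// exprn_ge0// addr_ge0// mulr_ge0// ltW.
move=> [//|n]; rewrite ltnS => Nn; rewrite -mulrA.
have K1 : 0 <= (1 + K * r0) ^+ m.+2 by rewrite exprn_ge0// addr_ge0// mulr_ge0// ltW.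
(* Back to y: the denominator of the odds is at most 1 + K r0. *)
apply: le_trans (ler_wpM2l K1 (hM _ (leqW Nn))); rewrite /e -evolve_scale.
apply: (evolve_le hd) => //.
  by move=> k; exact: power_step01 (ltW halpha).
  by move=> k; exact: power_step01 (ltW hbeta).
move=> z hz; rewrite -exprMn; have rn10 : 0 < rho n.+1 := power_step_gt0 beta n r10.
have [_ h _] := hN _ Nn.
have Kr : 0 < K * rho n.+1 by exact: mulr_gt0.
have zo := hz.1 o; have zo1 := simplex_le1 o hz.
apply: lerXn2r; rewrite ?nnegrE.
- by rewrite subr_ge0.
- by rewrite mulr_ge0 ?odds_ge0 ?(ltW Kr)// addr_ge0// mulr_ge0// ltW.
rewrite /odds mulrCA ler_peMr ?subr_ge0// ler_pdivlMr; last by lra.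
rewrite mul1r; apply: lerD => //; apply: ler_wpM2l => //; exact: ltW.
Qed.

End BestArmMoments.

(** * Moments of the other arms *)

Section ErrorBound.
Context (R : realFieldType).

Lemma exprD_le (k : nat) (a b : R) : 0 <= a -> 0 <= b -> (a + b) ^+ k <= 2 ^+ k * (a ^+ k + b ^+ k).
Proof.
move=> a0 b0; wlog ab : a b a0 b0 / a <= b.
  by move=> H; have [/H->//|/ltW/H h] := leP a b; rewrite addrC [_ ^+ k + _]addrC h.
apply: (@le_trans _ _ ((2 * b) ^+ k)); first by apply: lerXn2r; rewrite ?nnegrE; lra.
by rewrite exprMn ler_wpM2l ?exprn_ge0// lerDr exprn_ge0.
Qed.

(** To be read with y = 1 - X^o, s = rho_n, r = rho_{n+1}, g = gamma_{n+1}, tau = n^(-e) and t the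
    bound on the displacement of the target relative to g. When the moments of y are those of s,
    each of the four monomials has expectation O(s^(2k) tau^k). *)
Lemma error_bound (k : nat) (C0 : R) : 0 <= C0 ->
  exists2 C, 0 <= C & forall y s tau r t g, 0 <= y -> 0 <= r -> 0 <= t -> 0 <= g ->
    r <= s -> s <= tau -> tau <= 1 -> t <= C0 * (s * tau) -> g <= C0 * (s * tau) ->
    (y ^+ 2 + 4 * r * y + 2 * t) ^+ (2 * k) + (g * (y + r ^+ 2 + t ^+ 2) + g ^+ 2) ^+ k
    <= C * (y ^+ (4 * k) + s ^+ (2 * k) * y ^+ (2 * k) + (s * tau) ^+ k * y ^+ k
            + s ^+ (2 * k) * tau ^+ k).
Proof.
move=> C00.
pose C1 := C0 * (1 + C0 ^+ 2) + C0 ^+ 2.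
have C10 : 0 <= C1 by rewrite /C1; have := sqr_ge0 C0; nra.
pose A := 2 ^+ (2 * k) : R.
have A1 : 1 <= A by rewrite /A -natrX ler1n expn_gt0.
pose B := 2 ^+ k : R.
have B1 : 1 <= B by rewrite /B -natrX ler1n expn_gt0.
have D1 : 0 <= (4 : R) ^+ (2 * k) by exact: exprn_ge0.
have D2 : 0 <= (2 * C0) ^+ (2 * k) by apply: exprn_ge0; lra.
have D3 : 0 <= C0 ^+ k by exact: exprn_ge0.
have D4 : 0 <= C1 ^+ k by exact: exprn_ge0.
exists (A * A * (1 + 4 ^+ (2 * k) + (2 * C0) ^+ (2 * k)) + B * (C0 ^+ k + C1 ^+ k)).
  by apply: addr_ge0; apply: mulr_ge0; nra.
move=> y s tau r t g y0 r0 t0 g0 rs st tau1 tC gC.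
have s0 : 0 <= s by lra.
have tau0 : 0 <= tau by lra.
have stau : 0 <= s * tau by exact: mulr_ge0.
have b1 : (y ^+ 2 + 4 * r * y + 2 * t) ^+ (2 * k) <=
    A * A * (y ^+ (4 * k) + 4 ^+ (2 * k) * (s ^+ (2 * k) * y ^+ (2 * k))
      + (2 * C0) ^+ (2 * k) * (s ^+ (2 * k) * tau ^+ k)).
  have sy : r * y <= s * y by exact: ler_wpM2r.
  have ry0 : 0 <= r * y by exact: mulr_ge0.
  have y20 : 0 <= y ^+ 2 by exact: sqr_ge0.
  apply: (@le_trans _ _ ((y ^+ 2 + 4 * (s * y) + 2 * C0 * (s * tau)) ^+ (2 * k))).
    by apply: lerXn2r; rewrite ?nnegrE; lra.
  have C0s : 0 <= C0 * (s * tau) by exact: mulr_ge0.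
  apply: le_trans (exprD_le _ _ _) _; [lra|lra|].
  have -> : (4 * k = 2 * (2 * k))%N by rewrite mulnA.
  rewrite (exprM y) -/A -(mulrA A); apply: ler_wpM2l; first exact: exprn_ge0.
  rewrite mulrDr.
  have h1 : (y ^+ 2 + 4 * (s * y)) ^+ (2 * k) <= A * ((y ^+ 2) ^+ (2 * k) + 4 ^+ (2 * k) * (s ^+ (2 * k) * y ^+ (2 * k))).
    by rewrite -!exprMn; apply: exprD_le; lra.
  apply: lerD => //.
  have h2 : (2 * C0 * (s * tau)) ^+ (2 * k) <= (2 * C0) ^+ (2 * k) * (s ^+ (2 * k) * tau ^+ k).
    rewrite !exprMn -!mulrA; do 3! (apply: ler_wpM2l; first exact: exprn_ge0).
    rewrite (exprM tau); apply: lerXn2r; rewrite ?nnegrE ?sqr_ge0//.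
    by rewrite expr2 ler_piMr.
  apply: (le_trans h2); apply: ler_peMl => //; apply: mulr_ge0 => //.
  by apply: mulr_ge0; exact: exprn_ge0.
have b2 : (g * (y + r ^+ 2 + t ^+ 2) + g ^+ 2) ^+ k <=
    B * (C0 ^+ k * ((s * tau) ^+ k * y ^+ k) + C1 ^+ k * (s ^+ (2 * k) * tau ^+ k)).
  have r2 : r ^+ 2 <= s ^+ 2 by apply: lerXn2r.
  have st2 : (s * tau) ^+ 2 <= s ^+ 2 * tau.
    by rewrite exprMn ler_wpM2l ?sqr_ge0// expr2 ler_piMr.
  have s2tau : s ^+ 2 * tau <= s ^+ 2 by rewrite ler_piMr ?sqr_ge0.
  have C02 := sqr_ge0 C0.
  have t2 : t ^+ 2 <= C0 ^+ 2 * s ^+ 2.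
    apply: (@le_trans _ _ ((C0 * (s * tau)) ^+ 2)); first by apply: lerXn2r => //; rewrite nnegrE; exact: mulr_ge0.
    by rewrite exprMn ler_wpM2l//; exact: le_trans s2tau.
  have g2 : g ^+ 2 <= C0 ^+ 2 * (s ^+ 2 * tau).
    apply: (@le_trans _ _ ((C0 * (s * tau)) ^+ 2)); first by apply: lerXn2r => //; rewrite nnegrE; exact: mulr_ge0.
    by rewrite exprMn ler_wpM2l.
  have s3 : s * tau * s ^+ 2 <= s ^+ 2 * tau.
    rewrite (_ : s * tau * s ^+ 2 = s ^+ 2 * tau * s); last by ring.
    by rewrite ler_piMr ?mulr_ge0 ?sqr_ge0//; exact: le_trans tau1.
  have C0s : 0 <= C0 * (s * tau) by exact: mulr_ge0.
  have hb : g * (y + r ^+ 2 + t ^+ 2) + g ^+ 2 <= C0 * (s * tau * y) + C1 * (s ^+ 2 * tau).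
    have h1 : g * y <= C0 * (s * tau) * y by exact: ler_wpM2r.
    have h2 : g * (r ^+ 2 + t ^+ 2) <= C0 * (s * tau) * ((1 + C0 ^+ 2) * s ^+ 2).
      by apply: ler_pM => //; [apply: addr_ge0; exact: sqr_ge0|lra].
    have h3 : C0 * (1 + C0 ^+ 2) * (s * tau * s ^+ 2) <= C0 * (1 + C0 ^+ 2) * (s ^+ 2 * tau).
      by apply: ler_wpM2l => //; apply: mulr_ge0 => //; lra.
    rewrite /C1; lra.
  have r20 := sqr_ge0 r; have t20 := sqr_ge0 t; have g20 := sqr_ge0 g; have s20 := sqr_ge0 s.
  apply: (@le_trans _ _ ((C0 * (s * tau * y) + C1 * (s ^+ 2 * tau)) ^+ k)).
    apply: lerXn2r => //; rewrite nnegrE; first by rewrite addr_ge0 ?mulr_ge0 ?addr_ge0.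
    by rewrite addr_ge0 ?mulr_ge0.
  rewrite (exprM s) -!exprMn; apply: exprD_le; first by rewrite mulr_ge0// mulr_ge0.
  by rewrite mulr_ge0// mulr_ge0.
apply: le_trans (lerD b1 b2) _.
set a1 := y ^+ (4 * k); set a2 := s ^+ (2 * k) * y ^+ (2 * k).
set a3 := (s * tau) ^+ k * y ^+ k; set a4 := s ^+ (2 * k) * tau ^+ k.
have a10 : 0 <= a1 by exact: exprn_ge0.
have a20 : 0 <= a2 by apply: mulr_ge0; exact: exprn_ge0.
have a30 : 0 <= a3 by apply: mulr_ge0; exact: exprn_ge0.
have a40 : 0 <= a4 by apply: mulr_ge0; exact: exprn_ge0.
move: a1 a2 a3 a4 a10 a20 a30 a40 => a1 a2 a3 a4 a10 a20 a30 a40.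
move: D1 D2 D3 D4; move: (4 ^+ _) ((2 * C0) ^+ _) (C0 ^+ k) (C1 ^+ k) => d1 d2 d3 d4 D1 D2 D3 D4.
have F1 : a1 + d1 * a2 + d2 * a4 <= (1 + d1 + d2) * (a1 + a2 + a3 + a4).
  have e1 := mulr_ge0 D1 a10; have e2 := mulr_ge0 D2 a10; have e3 := mulr_ge0 D1 a30.
  have e4 := mulr_ge0 D2 a20; have e5 := mulr_ge0 D1 a40; have e6 := mulr_ge0 D2 a30.
  by clear - e1 e2 e3 e4 e5 e6 a10 a20 a30 a40; lra.
have F2 : d3 * a3 + d4 * a4 <= (d3 + d4) * (a1 + a2 + a3 + a4).
  have e1 := mulr_ge0 D3 a10; have e2 := mulr_ge0 D4 a10; have e3 := mulr_ge0 D3 a20.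
  have e4 := mulr_ge0 D4 a20; have e5 := mulr_ge0 D3 a40; have e6 := mulr_ge0 D4 a30.
  by clear - e1 e2 e3 e4 e5 e6; lra.
have AA : 0 <= A * A by apply: mulr_ge0; lra.
have B0 : 0 <= B by lra.
have := lerD (ler_wpM2l AA F1) (ler_wpM2l B0 F2).
by clear; lra.
Qed.

(** With n the even exponent, the linear drift contracts w^n by n lam g. Two uses of [young_power],
    for the drift error and for the variance, spend lam g each, and n >= 4 leaves more than lam
    g. *)
Lemma moment_recursion (j : nat) (lam : R) : 0 < lam ->
  exists2 C, 0 <= C & forall g w S1 S2 r Y, 0 < g -> 0 <= r -> 0 <= Y -> 0 <= S2 ->
    `|S1 + g * lam * w| <= g * r -> S2 <= 4 * g ^+ 2 * Y ->
    w ^+ (2 * j.+1).+2 + (2 * j.+1).+2%:R * w ^+ (2 * j.+1).+1 * S1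
      + (2 * j.+1).+2%:R ^+ 2 * (`|w| + 3 * g) ^+ (2 * j.+1) * S2
    <= (1 - lam * g) * w ^+ (2 * j.+1).+2
      + C * g * (r ^+ (2 * j.+1).+2 + (g * Y + g ^+ 2) ^+ j.+2).
Proof.
move=> lam0; pose n : R := (2 * j.+1).+2%:R.
have n4 : 4 <= n by rewrite /n ler_nat mulnS.
have n0 : 0 <= n by lra.
have [Ca Ca0 hCa] := young_power (2 * j.+1) n0 lam0.
have D0 : 0 <= n ^+ 2 * (18 ^+ j.+1 * 4) by rewrite mulr_ge0 ?sqr_ge0// mulr_ge0// exprn_ge0.
have [Cb Cb0 hCb] := young_power j D0 lam0.
exists (Ca + Cb); first exact: addr_ge0.
move=> g w S1 S2 r Y g0 r0 Y0 S20 S1b S2b; have g0' := ltW g0.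
have Qm : (2 * j.+2 = (2 * j.+1).+2)%N by rewrite mulnS.
rewrite -/n; move mE: (2 * j.+1)%N Qm hCa => m Qm hCa.
move ZE: (g * Y + g ^+ 2) => Z.
have g20 := sqr_ge0 g.
have gY : 0 <= g * Y by exact: mulr_ge0.
have Z0 : 0 <= Z by rewrite -ZE addr_ge0.
have gZ : g ^+ 2 <= Z by rewrite -ZE lerDr.
have VE : w ^+ m.+2 = `|w| ^+ m.+2 by rewrite -Qm !exprM real_normK ?num_real.
have VE2 : w ^+ m.+2 = (w ^+ 2) ^+ j.+2 by rewrite -Qm exprM.
move VV : (w ^+ m.+2) VE VE2 => V VE VE2.
have V0 : 0 <= V by rewrite VE exprn_ge0.
have T1 : n * (w ^+ m.+1 * S1) <= - (n * g * lam * V) + g * (lam * V + Ca * r ^+ m.+2).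
  have -> : w ^+ m.+1 * S1 = w ^+ m.+1 * (S1 + g * lam * w) - g * lam * V.
    by rewrite -VV (exprS w m.+1); ring.
  have h1 : w ^+ m.+1 * (S1 + g * lam * w) <= `|w| ^+ m.+1 * (g * r).
    apply: le_trans (ler_norm _) _; rewrite normrM normrX.
    by apply: ler_wpM2l => //; exact: exprn_ge0.
  have h2 : `|w| ^+ m.+1 <= (`|w| + r) ^+ m.+1.
    by apply: lerXn2r; rewrite ?nnegrE ?lerDl//; exact: addr_ge0.
  have h3 := hCa _ _ (normr_ge0 w) r0.
  have h4 := ler_wpM2r (mulr_ge0 g0' r0) h2.
  have h5 := ler_wpM2l g0' h3.
  have h6 := ler_wpM2l n0 (le_trans h1 h4).
  rewrite VE; move: h5 h6; clear.
  by move: (w ^+ m.+1 * _) (`|w| ^+ m.+2) ((`|w| + r) ^+ m.+1) => s1 s2 s4; lra.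
have T2 : n ^+ 2 * (`|w| + 3 * g) ^+ m * S2 <= g * (lam * V + Cb * Z ^+ j.+2).
  have h1 : (`|w| + 3 * g) ^+ m <= 18 ^+ j.+1 * (w ^+ 2 + Z) ^+ j.+1.
    rewrite -mE exprM -exprMn; have w20 := sqr_ge0 w.
    (* (a + 3 g)^2 <= 2 a^2 + 18 g^2, and g^2 <= Z. *)
    have hsq : (`|w| + 3 * g) ^+ 2 <= 18 * (w ^+ 2 + Z).
      rewrite -(real_normK (num_real w)).
      have := sqr_ge0 `|w|; have := sqr_ge0 (`|w| - 3 * g); move: gZ; clear.
      by move: `|w| => a; lra.
    apply: lerXn2r => //; rewrite nnegrE; first exact: sqr_ge0.
    by rewrite mulr_ge0// addr_ge0.
  have h2 : S2 <= 4 * g * Z.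
    apply: (le_trans S2b); have := mulr_ge0 g0' g20; rewrite -ZE; clear; lra.
  have h3 := hCb _ _ (sqr_ge0 w) Z0.
  rewrite VE2; apply: le_trans (ler_wpM2l g0' h3).
  have wg0 : 0 <= (`|w| + 3 * g) ^+ m.
    by apply: exprn_ge0; apply: addr_ge0 => //; rewrite mulr_ge0.
  have := ler_wpM2l (sqr_ge0 n) (ler_pM wg0 S20 h1 h2).
  clear; move: ((`|w| + _) ^+ m) ((w ^+ 2 + Z) ^+ j.+1) (18 ^+ _) => s1 s2 s4; lra.
have U1 : 0 <= Ca * g * Z ^+ j.+2 by apply: mulr_ge0; [exact: mulr_ge0|exact: exprn_ge0].
have U2 : 0 <= Cb * g * r ^+ m.+2 by apply: mulr_ge0; [exact: mulr_ge0|exact: exprn_ge0].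
have U4 : 0 <= g * lam * V := mulr_ge0 (mulr_ge0 g0' (ltW lam0)) V0.
have U3 := ler_wpM2r U4 n4.
rewrite -mulrA.
move: T1 T2 U1 U2 U3 U4; clear.
by move: (n * (w ^+ _ * _)) (n ^+ 2 * _ * _) (Z ^+ _) (r ^+ _) => s1 s2 s3 s4; lra.
Qed.

End ErrorBound.

Section OtherArms.
Context (R : realType) (d : nat) (hd : (1 < d)%N)
    (p : 'I_d -> R) (hp01 : forall j, 0 < p j < 1)
    (sigma : R) (hsigma : 0 < sigma <= 1)
    (o : 'I_d) (delta : R) (hdelta : 0 < delta)
    (hgap : forall i, i != o -> p i <= p o - delta).

Local Notation W := (round_weight p sigma).

(* The target [c * r] balances the drift: [lam * c * r = r * q / (d - 1)]. *)
Lemma other_moment_step (j : nat) (i : 'I_d) : i != o ->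
  let lam := p o - p i in
  let c := (1 - sigma * p o) / ((d%:R - 1) * lam) in
  exists2 C, 0 <= C & forall (g r b t : R) (x : 'rV[R]_d), simplex x ->
    0 < g <= 1 -> 0 < r <= 1 -> 0 <= b <= g * t -> t <= 1 ->
    let y := 1 - x 0 o in
    is_true (\sum_k W x k * (round_next g r x k 0 i - c * r) ^+ (2 * j.+2)
    <= (1 - lam * g) * (x 0 i - c * r - b) ^+ (2 * j.+2)
      + C * g * ((y ^+ 2 + 4 * r * y + 2 * t) ^+ (2 * j.+2)
            + (g * (y + r ^+ 2 + t ^+ 2) + g ^+ 2) ^+ j.+2)).
Proof.
move=> io lam c.
have lam0 : 0 < lam by have := hgap io; have := hdelta; rewrite /lam; lra.
have lam1 : lam <= 1 by have := hp01 i; have := hp01 o; rewrite /lam => /andP[? ?] /andP[? ?]; lra.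
have Qm : (2 * j.+2 = (2 * j.+1).+2)%N by rewrite mulnS.
have [C C0 hC] := moment_recursion j lam0.
exists C => //.
move=> g r b t x hx /andP[g0 g1] /andP[r0 r1] /andP[b0 bt] t1 y.
have g0' := ltW g0; have r0' := ltW r0.
have t0 : 0 <= t by rewrite -(pmulr_rge0 _ g0); exact: le_trans bt.
have dg := natrB1_ge1 R hd.
have y0 : 0 <= y by rewrite subr_ge0 simplex_le1.
have xiy : x 0 i <= y.
  by rewrite /y -(sum_others o hx) (bigD1 i)//= lerDl sumr_ge0// => l _; exact: hx.1.
have xi0 := hx.1 i.
have hmean := other_drift hd hp01 hsigma hdelta hgap io hx g0' r0'.
have hsec := second_moment_increment hd hp01 hsigma i hx g0' r0'.
pose h k := round_next g r x k 0 i - x 0 i.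
(* [b] stands for c (rho_n - rho_{n+1}): [w] is the deviation from the target before the round, and
   the displacement of the target joins the increment. *)
pose w := x 0 i - c * r - b.
have W0 k : 0 <= W x k by apply: round_weight_ge0 hx.1.
have W1 := sum_round_weight p sigma hx.
have hb k : `|w| + `|h k + b| <= `|w| + 3 * g.
  rewrite lerD2l; apply: le_trans (ler_normD _ _) _; rewrite (ger0_norm b0).
  have := increment_bound hd k i hx g0' r0'; rewrite -/(h k).
  have : g * ((if k.1.1 == i then 1 - x 0 i else x 0 i) + r) <= g * 2.
    by apply: ler_wpM2l => //; have := simplex_le1 i hx; case: ifP => _; lra.
  have : g * t <= g * 1 by exact: ler_wpM2l.
  by lra.
have E k : round_next g r x k 0 i - c * r = w + (h k + b) by rewrite /w /h; ring.
under eq_bigr do rewrite E.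
rewrite Qm; apply: le_trans (moment_expansion (2 * j.+1) W0 W1 hb) _.
have S1 : \sum_k W x k * (h k + b) = \sum_k W x k * h k + b.
  by under eq_bigr do rewrite mulrDr; rewrite big_split /= -mulr_suml W1 mul1r.
pose R' := y ^+ 2 + 4 * r * y + 2 * t.
have R'0 : 0 <= R'.
  have y20 := sqr_ge0 y; have ry := mulr_ge0 r0' y0; rewrite /R'; lra.
(* By the choice of [c], the inflow cancels lam c r; there remain the error of [other_drift] and
   [b * (1 - g * lam)]. *)
have S1b : `|\sum_k W x k * (h k + b) + g * lam * w| <= g * R'.
  have -> : \sum_k W x k * (h k + b) + g * lam * w =
    (\sum_k W x k * h k - g * (r * ((1 - sigma * p o) / (d%:R - 1)) - lam * x 0 i)) + b * (1 - g * lam).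
    rewrite S1 /w /c; field; rewrite gt_eqF//=; lra.
  apply: le_trans (ler_normD _ _) _.
  have -> : g * R' = g * (y ^+ 2 + 4 * r * y) + g * (2 * t) by rewrite /R'; ring.
  apply: lerD; first exact: hmean.
  have gl : 0 <= g * lam by apply: mulr_ge0 => //; exact: ltW.
  have gl1 : g * lam <= 1 by rewrite mulr_ile1// ltW.
  rewrite ger0_norm; last by apply: mulr_ge0 => //; lra.
  have : b * (1 - g * lam) <= b by rewrite ler_piMr//; lra.
  have : 0 <= g * t by exact: mulr_ge0.
  by lra.
have S2b : \sum_k W x k * (h k + b) ^+ 2 <= 4 * g ^+ 2 * (y + r ^+ 2 + t ^+ 2).
  apply: (@le_trans _ _ (\sum_k (W x k * h k ^+ 2) *+ 2 + 2 * b ^+ 2)).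
    rewrite -[2 * b ^+ 2]mul1r -[X in X * (2 * b ^+ 2)]W1 mulr_suml -big_split /=.
    apply: ler_sum => k _; rewrite -mulr_natr -mulrA -mulrDr; apply: ler_wpM2l => //.
    by have := sqr_ge0 (h k - b); lra.
  rewrite sumrMnl -mulr_natr.
  have hx1 : x 0 i * (1 - x 0 i) <= y by apply: le_trans xiy; rewrite ler_piMr//; lra.
  have g20 := sqr_ge0 g.
  have h1 := ler_wpM2l g20 hx1.
  have b2 : b ^+ 2 <= (g * t) ^+ 2 by apply: lerXn2r => //; rewrite nnegrE; exact: le_trans bt.
  have h2 : 0 <= g ^+ 2 * t ^+ 2 by rewrite mulr_ge0 ?sqr_ge0.
  rewrite exprMn in b2; have := hsec; rewrite -/(h _) => hs.
  by lra.
have Y0 : 0 <= y + r ^+ 2 + t ^+ 2.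
  by apply: addr_ge0; [apply: addr_ge0 => //|]; exact: sqr_ge0.
have S20 : 0 <= \sum_k W x k * (h k + b) ^+ 2.
  by apply: sumr_ge0 => k _; rewrite mulr_ge0 ?sqr_ge0.
exact: hC g0 R'0 Y0 S20 S1b S2b.
Qed.

End OtherArms.

Section OtherArmMoments.
Context (R : realType) (d : nat) (hd : (1 < d)%N)
    (p : 'I_d -> R) (hp01 : forall j, 0 < p j < 1)
    (sigma : R) (hsigma : 0 < sigma <= 1)
    (o : 'I_d) (delta : R) (hdelta : 0 < delta)
    (hgap : forall i, i != o -> p i <= p o - delta)
    (alpha beta gamma1 rho1 : R)
    (halpha : 0 < alpha) (halpha1 : alpha < 1) (hbeta : 0 < beta) (hab : beta < alpha)
    (hgamma1 : 0 < gamma1 < 1) (hrho1 : 0 < rho1 < 1)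
    (x0 : 'rV[R]_d) (hx0 : simplex x0).

Let gamma := power_step gamma1 alpha.
Let rho := power_step rho1 beta.
Local Notation E := (evolve p sigma gamma rho 0).

Lemma best_arm_moment_ge2 k : (1 < k)%N -> exists C N, 0 <= C /\ forall n, (N <= n)%N ->
  E n (fun x => (1 - x 0 o) ^+ k) x0 <= C * rho n ^+ k.
Proof.
case: k => [|[|m]]// _; apply: (best_arm_moment hd hp01 hsigma hdelta hgap) => //.
exact: ltW.
Qed.

Lemma other_arm_moment (i : 'I_d) (e0 : R) (j : nat) : i != o ->
  0 < e0 -> e0 <= beta -> e0 <= 1 - alpha -> e0 <= alpha - beta ->
  let c := (1 - sigma * p o) / ((d%:R - 1) * (p o - p i)) in
  exists C N, 0 <= C /\ forall n, (N <= n)%N ->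
  E n (fun x => (x 0 i - c * rho n) ^+ (2 * j.+2)) x0
    <= C * (rho n ^+ (2 * j.+2) * (n%:R `^ (- e0)) ^+ j.+2).
Proof.
move=> io e00 e0b e0a e0ab c.
have /andP[r10 r11] := hrho1; have /andP[g10 g11] := hgamma1.
have [C C00 hstep] := other_moment_step hd hp01 hsigma hdelta hgap j io.
pose lam := p o - p i.
have dg := natrB1_ge1 R hd.
have lam0 : 0 < lam by have := hgap io; have := hdelta; rewrite /lam; lra.
have lam1 : lam <= 1 by have := hp01 i; have := hp01 o; rewrite /lam => /andP[? ?] /andP[? ?]; lra.
have c0 : 0 < c.
  apply: divr_gt0; first exact: (failure_prob_gt0 hp01 hsigma).
  by apply: mulr_gt0 => //; lra.
(* The first entry serves gamma_{n+1} <= C0 rho_n tau_n, the second the displacement of the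
   target. *)
pose C0 := Num.max (gamma1 / rho1) (2 * c * beta / gamma1).
have C0a : gamma1 / rho1 <= C0 by rewrite le_max lexx.
have C0b : 2 * c * beta / gamma1 <= C0 by rewrite le_max lexx orbT.
have C0p : 0 < C0 by apply: lt_le_trans C0a; rewrite divr_gt0.
have [Ce Ce0 herr] := error_bound j.+2 (ltW C0p).
have [M1 [N1 [M10 hM1]]] := @best_arm_moment_ge2 (4 * j.+2) isT.
have [M2 [N2 [M20 hM2]]] := @best_arm_moment_ge2 (2 * j.+2) isT.
have [M3 [N3 [M30 hM3]]] := @best_arm_moment_ge2 j.+2 isT.
pose tau n := n%:R `^ (- e0) : R.
(* The exponent for which the claimed rate [v n] is a constant times n^(-T). *)
pose T := beta * (2 * j.+2)%:R + e0 * j.+2%:R.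
have T0 : 0 <= T by rewrite addr_ge0// mulr_ge0// ltW.
have lg0 : 0 < lam / 2 * gamma1 by rewrite mulr_gt0// divr_gt0.
have [N4 hN4] := inv_eventually_le halpha1 T0 lg0.
have Ci0 : 0 < C0^-1 by rewrite invr_gt0.
have [N5 hN5] := powR_eventually_le e00 Ci0.
pose N := (maxn (maxn N1 (maxn N2 N3)) (maxn N4 N5)).+1.
pose v n := rho n ^+ (2 * j.+2) * tau n ^+ j.+2.
pose e n := E n (fun x => (x 0 i - c * rho n) ^+ (2 * j.+2)) x0.
have N0 n : (N <= n)%N -> (0 < n)%N by case: n.
have vE n : (0 < n)%N -> v n = rho1 ^+ (2 * j.+2) * n%:R `^ (- T).
  move=> n0; have tE : tau n ^+ j.+2 = power_step 1 e0 n ^+ j.+2 by rewrite /power_step mul1r.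
  rewrite /v tE /rho !power_step_exp expr1n mul1r -mulrA -powRD; last first.
    by apply/implyP => _; rewrite gt_eqF// ltr0n.
  by rewrite /T opprD.
have rho0 n : (N <= n)%N -> 0 < rho n by case: n => // n _; exact: power_step_gt0.
have tau0 n : (N <= n)%N -> 0 < tau n by move=> /N0 n0; rewrite powR_gt0// ltr0n.
have v0 n : (N <= n)%N -> 0 < v n.
  by move=> Nn; rewrite mulr_gt0// exprn_gt0// ?rho0// tau0.
(* [e0 <= beta] gives rho <= tau, and [e0 <= alpha - beta] the bound on gamma. *)
have facts n : (N <= n)%N -> [/\ rho n.+1 <= rho n, rho n <= tau n, tau n <= 1,
    gamma n.+1 <= C0 * (rho n * tau n) & C0 * (rho n * tau n) <= 1].
  move=> Nn; have n0 := N0 _ Nn; have rn0 := rho0 _ Nn; have tn0 := tau0 _ Nn.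
  have f2 : rho n <= tau n.
    apply: (@le_trans _ _ (n%:R `^ (- beta))); last exact: natr_powR_nincr.
    by rewrite /rho /power_step ler_piMl ?powR_ge0// ltW.
  have f3 : tau n <= 1.
    by apply: le_trans (natr_powR_nincr n0 (ltW e00)) _; rewrite oppr0 powRr0.
  split => //.
  - by apply: power_step_nincr => //; exact: ltW.
  - have gp : gamma n.+1 <= gamma n by apply: power_step_nincr => //; exact: ltW.
    apply: (le_trans gp); apply: (@le_trans _ _ (gamma1 / rho1 * (rho n * tau n))); last first.
      by apply: ler_wpM2r => //; rewrite mulr_ge0// ltW.
    rewrite /gamma /rho /tau /power_step !mulrA divfK ?gt_eqF// -mulrA.
    apply: ler_wpM2l; first exact: ltW.
    rewrite -powRD; last by apply/implyP => _; rewrite gt_eqF// ltr0n.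
    by rewrite -opprD; apply: natr_powR_nincr => //; lra.
  - have Nn5 : (N5 <= n)%N by move: Nn; rewrite /N !gtn_max => /and3P[_ _ /ltnW].
    apply: (@le_trans _ _ (C0 * tau n)).
      apply: ler_wpM2l; first exact: ltW.
      by rewrite ler_piMl ?(ltW tn0)//; exact: le_trans f3.
    by rewrite mulrC -ler_pdivlMr// mul1r; exact: hN5.
(* The displacement is at most c beta rho_n / n, and [e0 <= 1 - alpha] converts 1 / n into
   gamma_{n+1} tau_n. *)
have hb n : (N <= n)%N -> 0 <= c * (rho n - rho n.+1) <= gamma n.+1 * (C0 * (rho n * tau n)).
  move=> Nn; have n0 := N0 _ Nn; have rn0 := rho0 _ Nn; have tn0 := tau0 _ Nn.
  have [f1 _ _ _ _] := facts _ Nn.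
  apply/andP; split; first by rewrite mulr_ge0 ?(ltW c0)// subr_ge0.
  have h1 : rho n - rho n.+1 <= beta * n%:R^-1 * rho n.
    have := ler_wpM2l (ltW r10) (powR_natS_ge (ltW hbeta) n0).
    by rewrite /rho /power_step; move: (_ `^ _) (_ `^ _) => a1 a2; lra.
  have h2 := inv_le_powR n0 (ltW e00) e0a.
  have br : 0 <= c * (beta * rho n) by rewrite mulr_ge0 ?(ltW c0)// mulr_ge0// ltW.
  have st : 0 <= rho n * tau n by rewrite mulr_ge0// ltW.
  have gn0 : 0 <= gamma n.+1 by rewrite power_step_ge0// ltW.
  apply: (le_trans (ler_wpM2l (ltW c0) h1)).
  have -> : c * (beta * n%:R^-1 * rho n) = c * (beta * rho n) * n%:R^-1 by ring.
  apply: (le_trans (ler_wpM2l br h2)).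
  apply: (le_trans _ (ler_wpM2l gn0 (ler_wpM2r st C0b))).
  rewrite le_eqVlt; apply/orP; left; apply/eqP; rewrite /gamma /tau /power_step.
  by field; rewrite gt_eqF.
have g01 n : 0 < gamma n.+1 <= 1.
  by rewrite power_step_gt0//; case/andP: (power_step01 n hgamma1 (ltW halpha)).
have r01 n : 0 < rho n.+1 <= 1.
  by rewrite power_step_gt0//; case/andP: (power_step01 n hrho1 (ltW hbeta)).
have hg n : 0 <= gamma n.+1 <= 1 by have /andP[? ->] := g01 n; rewrite ltW.
have hr n : 0 <= rho n.+1 <= 1 by have /andP[? ->] := r01 n; rewrite ltW.
pose D := C * (Ce * (M1 + M2 + M3 + 1)).
have D0 : 0 <= D by rewrite mulr_ge0// mulr_ge0// !addr_ge0.
have he n : (N <= n)%N -> e n.+1 <= (1 - lam * gamma n.+1) * e n + D * gamma n.+1 * v n.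
  move=> Nn; have [f1 f2 f3 f4 f5] := facts _ Nn.
  have rn0 := rho0 _ Nn; have tn0 := tau0 _ Nn.
  have /andP[gn0 gn1] := hg n.
  pose A (x : 'rV[R]_d) := (x 0 i - c * rho n) ^+ (2 * j.+2) : R.
  pose Y k (x : 'rV[R]_d) := (1 - x 0 o) ^+ k.
  (* The monomials of [error_bound] are nested as binary combinations, to which [evolve_lin]
     applies. *)
  pose G3 x := (rho n * tau n) ^+ j.+2 * Y j.+2 x + v n * (fun=> 1) x.
  pose G2 x := rho n ^+ (2 * j.+2) * Y (2 * j.+2)%N x + 1 * G3 x.
  pose G1 x := 1 * Y (4 * j.+2)%N x + 1 * G2 x.
  pose G x := C * gamma n.+1 * Ce * G1 x.
  have EG : E n G x0 = C * gamma n.+1 * Ce * (1 * E n (Y (4 * j.+2)%N) x0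
      + 1 * (rho n ^+ (2 * j.+2) * E n (Y (2 * j.+2)%N) x0
      + 1 * ((rho n * tau n) ^+ j.+2 * E n (Y j.+2) x0 + v n * 1))).
    transitivity (C * gamma n.+1 * Ce * E n G1 x0); first exact: evolve_scale.
    congr (_ * _); transitivity (1 * E n (Y (4 * j.+2)%N) x0 + 1 * E n G2 x0); first exact: evolve_lin.
    congr (_ + 1 * _).
    transitivity (rho n ^+ (2 * j.+2) * E n (Y (2 * j.+2)%N) x0 + 1 * E n G3 x0); first exact: evolve_lin.
    congr (_ + 1 * _).
    rewrite -(evolve_cst hd p sigma hg hr 0 n 1 hx0).
    exact: evolve_lin.
  rewrite /e; apply: (@le_trans _ _ (E n (fun x => (1 - lam * gamma n.+1) * A x + 1 * G x) x0)).
    apply: (evolveS_le hd hp01 hsigma hg hr hx0) => x hx.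
    have st0 : 0 <= C0 * (rho n * tau n) by rewrite !mulr_ge0// ltW.
    apply: le_trans (hstep _ _ _ _ _ hx (g01 n) (r01 n) (hb _ Nn) f5) _.
    apply: lerD.
      by rewrite /A le_eqVlt; apply/orP; left; apply/eqP; congr (_ * _ ^+ _); rewrite -/c; ring.
    rewrite mul1r /G -(mulrA (C * gamma n.+1)); apply: ler_wpM2l; first exact: mulr_ge0.
    have /andP[rn10 _] := hr n.
    have y0 : 0 <= 1 - x 0 o by rewrite subr_ge0 simplex_le1.
    apply: le_trans (herr _ _ _ _ _ _ y0 rn10 st0 gn0 f1 f2 f3 (lexx _) f4) _.
    by rewrite /G1 /G2 /G3 !mul1r mulr1 !addrA.
  rewrite (evolve_lin p sigma gamma rho 0 n _ _ A G) lerD2l mul1r EG.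
  have -> : D * gamma n.+1 * v n = C * gamma n.+1 * Ce * ((M1 + M2 + M3 + 1) * v n).
    by rewrite /D; ring.
  apply: ler_wpM2l; first exact: (mulr_ge0 (mulr_ge0 C00 gn0) Ce0).
  have /and3P[n1 n2 n3] : [&& (N1 <= n)%N, (N2 <= n)%N & (N3 <= n)%N].
    by move: Nn; rewrite /N !gtn_max => /andP[/and3P[/ltnW -> /ltnW -> /ltnW ->]].
  have a1 := hM1 n n1; have a2 := hM2 n n2; have a3 := hM3 n n3.
  have p1 : 0 <= rho n ^+ (2 * j.+2) by rewrite exprn_ge0// ltW.
  have p2 : 0 <= (rho n * tau n) ^+ j.+2 by rewrite exprn_ge0// mulr_ge0// ltW.
  have b2 := ler_wpM2l p1 a2; have b3 := ler_wpM2l p2 a3.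
  (* Every error is compared with [v n]: here rho^2 <= rho <= tau is used, and in [q3] the powers
     match exactly. *)
  have q1 : rho n ^+ (2 * j.+2) * rho n ^+ (2 * j.+2) <= v n.
    apply: ler_wpM2l => //; rewrite exprM; apply: lerXn2r; rewrite ?nnegrE ?sqr_ge0 ?(ltW tn0)//.
    apply: (le_trans _ f2); rewrite expr2 ler_piMr ?(ltW rn0)//; exact: le_trans f3.
  have q2 : rho n ^+ (4 * j.+2) = rho n ^+ (2 * j.+2) * rho n ^+ (2 * j.+2).
    by rewrite -exprD -mulnDl.
  have q3 : (rho n * tau n) ^+ j.+2 * rho n ^+ j.+2 = v n.
    by rewrite /v mul2n -addnn exprD exprMn; ring.
  rewrite q2 in a1.
  have w1 := ler_wpM2l M10 q1; have w2 := ler_wpM2l M20 q1.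
  have w3 : M3 * ((rho n * tau n) ^+ j.+2 * rho n ^+ j.+2) = M3 * v n by rewrite q3.
  move: a1 b2 b3 w1 w2 w3; rewrite /Y.
  move: (E n _ _) (E n _ _) (E n _ _) (v n) => E1 E2 E3 V.
  move: (rho n ^+ (2 * j.+2)) ((rho n * tau n) ^+ j.+2) (rho n ^+ j.+2) => x1 x2 x3; lra.
have [M M0 hM] : exists2 M, 0 <= M & forall n, (N <= n)%N -> e n <= M * v n.
  apply: (recursion_rate lam0 D0 v0 _ _ he).
  - move=> n _; have /andP[? ?] := hg n; rewrite mulr_ge0 ?(ltW lam0)//=.
    by rewrite mulr_ile1// ltW.
  - move=> n Nn; rewrite !vE ?(N0 _ Nn)// mulrCA; apply: ler_wpM2l; first by rewrite exprn_ge0// ltW.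
    apply: le_trans (powR_natS_ge T0 (N0 _ Nn)); apply: ler_wpM2r; first exact: powR_ge0.
    have Nn4 : (N4 <= n)%N.
      by move: Nn; rewrite /N !gtn_max => /andP[_ /andP[/ltnW]].
    have := hN4 _ Nn4; rewrite /gamma /power_step; lra.
by exists M, N.
Qed.

End OtherArmMoments.

(** * Almost sure convergence *)

(** Comparison with the telescoping series of 1 / ((n + 1)(n + 2)). *)
Lemma nneseries_inv_sqr_lty (R : realType) (u : nat -> \bar R) (C : R) (N : nat) :
  (forall n, 0 <= u n)%E -> (forall n, u n <= 1)%E ->
  (forall n, (N <= n)%N -> u n <= (C * n%:R `^ (- 2))%:E)%E ->
  (\sum_(n <oo) u n < +oo)%E.
Proof.
move=> u0 u1 hu; pose D := Num.max C 0.
have D0 : 0 <= D by rewrite le_max lexx orbT.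
have CD : C <= D by rewrite le_max lexx.
(* The first summand handles n <= N through u <= 1, the second the tail through (n + 1)(n + 2) <= 6
   n^2. *)
pose K := (N.+1 * N.+2)%:R + 6 * D : R.
have K0 : 0 <= K by rewrite addr_ge0// mulr_ge0.
pose w n := n.+1%:R^-1 - n.+2%:R^-1 : R.
have wE n : w n = (n.+1%:R * n.+2%:R)^-1.
  have nE : n.+2%:R = n.+1%:R + 1 :> R by rewrite natr1.
  rewrite /w nE; have : 0 < n.+1%:R :> R by rewrite ltr0n.
  by move: (n.+1%:R : R) => a a0; field; rewrite !gt_eqF//; lra.
have uw n : (u n <= (K * w n)%:E)%E.
  have n12 : 0 < n.+1%:R * n.+2%:R :> R by rewrite mulr_gt0.
  rewrite wE; have [nN|Nn] := leqP n N.
    apply: (le_trans (u1 n)); rewrite lee_fin ler_pdivlMr// mul1r.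
    apply: (@le_trans _ _ (N.+1 * N.+2)%:R); last by rewrite lerDl mulr_ge0.
    by rewrite -natrM ler_nat leq_mul.
  apply: (le_trans (hu _ (ltnW Nn))); rewrite lee_fin.
  have n1 : 1 <= n%:R :> R by rewrite ler1n (leq_ltn_trans _ Nn).
  have n0 : 0 < n%:R :> R by apply: lt_le_trans n1.
  rewrite powRN powR_mulrn ?ler0n// ler_pdivlMr// mulrAC ler_pdivrMr ?exprn_gt0//.
  have E1 : n.+1%:R = n%:R + 1 :> R by rewrite natr1.
  have E2 : n.+2%:R = n%:R + 2 :> R by rewrite -natrD addn2.
  have N0 : 0 <= (N.+1 * N.+2)%:R :> R by [].
  move: n12; rewrite /K E1 E2; move: ((N.+1 * N.+2)%:R : R) (n%:R : R) n1 n0 N0 => y x x1 x0' y0 n12.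
  have x2 : x * 1 <= x * x by apply: ler_wpM2l => //; exact: ltW.
  have h1 : (x + 1) * (x + 2) <= 6 * x ^+ 2 by rewrite expr2; lra.
  have h2 := ler_wpM2l D0 h1; have h3 := ler_wpM2r (ltW n12) CD.
  have h4 := mulr_ge0 y0 (sqr_ge0 x).
  by rewrite mulrDl; lra.
have sum_w n : \sum_(0 <= i < n) w i <= 1.
  have -> : \sum_(0 <= i < n) w i = 1 - n.+1%:R^-1.
    elim: n => [|n IH]; first by rewrite big_geq// invr1 subrr.
    by rewrite big_nat_recr//= IH /w addrA subrK.
  by rewrite gerBl invr_ge0.
apply: (@le_lt_trans _ _ K%:E); last exact: ltry.
apply: lime_le; first by apply: is_cvg_nneseries => n _ _; exact: u0.
apply: nearW => n; apply: (@le_trans _ _ (\sum_(0 <= i < n) (K * w i)%:E)%E).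
  by apply: lee_sum => i _; exact: uw.
by rewrite sumEFin lee_fin -mulr_sumr ler_piMr.
Qed.

Section AlmostSure.
Context (disp : measure_display) (T : measurableType disp)
    (R : realType) (P : probability T R) (d : nat) (hd : (1 < d)%N)
    (p : 'I_d -> R) (hp01 : forall j, 0 < p j < 1)
    (sigma : R) (hsigma : 0 < sigma <= 1)
    (gamma rho : nat -> R)
    (hgamma : forall n, 0 <= gamma n.+1 <= 1) (hrho : forall n, 0 <= rho n.+1 <= 1)
    (x0 : 'rV[R]_d)
    (A : nat -> 'I_d -> {RV P >-> bool}) (B : nat -> {RV P >-> bool})
    (I : nat -> T -> 'I_d) (X : nat -> T -> 'rV[R]_d)
    (hX : over_penalized_NS A B I p sigma gamma rho x0 X).

Local Notation E := (evolve p sigma gamma rho 0).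

Lemma simplex_start : simplex x0.
Proof. by split; [move=> j; exact/ltW/(ns_init_pos hX)|exact: (ns_init_sum hX)]. Qed.

Lemma simplex_state n w : simplex (X n w).
Proof.
elim: n => [|n IH]; first by rewrite (ns_start hX); exact: simplex_start.
rewrite (ns_rec hX).
exact: (@simplex_next R d hd _ _ _ (I n.+1 w, A n.+1 (I n.+1 w) w, B n.+1 w)).
Qed.

(** Markov's inequality inside [evolve], with an even power so that no sign matters, then
    Borel-Cantelli. *)
Lemma lim_sup_null (u : nat -> 'rV[R]_d -> R) (m : nat) (C : R) (N : nat) (e : R) :
  0 < e -> (forall n, (N <= n)%N -> E n (fun x => u n x ^+ (2 * m)) x0 <= C * n%:R `^ (- 2)) ->
  P (lim_sup_set (fun n => X n @^-1` [set x | e <= `|u n x|])) = 0%E.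
Proof.
move=> e0 hu; apply: lim_sup_set_cvg0 => [n|]; first exact: (state_measurable hX).
have em : 0 < (e ^+ (2 * m))^-1 by rewrite invr_gt0 exprn_gt0.
apply: (@nneseries_inv_sqr_lty _ _ ((e ^+ (2 * m))^-1 * C) N).
- by move=> n; exact: measure_ge0.
- by move=> n; apply: probability_le1; exact: (state_measurable hX).
move=> n Nn; apply: (le_trans (prob_state hp01 hsigma hX _ _)); rewrite lee_fin -mulrA.
apply: (le_trans _ (ler_wpM2l (ltW em) (hu n Nn))); rewrite -evolve_scale.
apply: (evolve_le hd hp01 hsigma hgamma hrho) => [|x _]; first exact: simplex_start.
have uu : 0 <= u n x ^+ (2 * m) by rewrite exprM exprn_ge0 ?sqr_ge0.
rewrite indicE; case: (boolP (x \in _)) => [|_]; last by rewrite mulr_ge0// ltW.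
rewrite inE /= => eu; rewrite ler_pdivlMl ?exprn_gt0// mulr1 exprM [leRHS]exprM.
by rewrite -(real_normK (num_real (u n x))); apply: lerXn2r; rewrite ?nnegrE ?sqr_ge0//;
  apply: lerXn2r; rewrite ?nnegrE ?(ltW e0).
Qed.

(** Countably many levels 1 / (k + 1) suffice, so one null set serves every [e]. *)
Lemma ae_cvg0 (u : nat -> 'rV[R]_d -> R) (m : nat) (C : R) (N : nat) :
  (forall n, (N <= n)%N -> E n (fun x => u n x ^+ (2 * m)) x0 <= C * n%:R `^ (- 2)) ->
  {ae P, forall w, u n (X n w) @[n --> \oo] --> 0}.
Proof.
move=> hu; pose F (k n : nat) := X n @^-1` [set x | k.+1%:R^-1 <= `|u n x|].
have nF : P.-negligible (\bigcup_k lim_sup_set (F k)).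
  apply: negligible_bigcup => k; exists (lim_sup_set (F k)); split => //.
    apply: bigcap_measurable => // n _; apply: bigcup_measurable => i _.
    exact: (state_measurable hX).
  by apply: lim_sup_null hu; rewrite invr_gt0.
apply: negligibleS nF => w /= hw; apply: contrapT => hF; apply: hw.
apply/cvgrPdist_lt => e e0.
have [k ke] : exists k, k.+1%:R^-1 < e.
  exists (Num.truncn e^-1); rewrite -[ltRHS]invrK ltf_pV2 ?posrE ?invr_gt0//.
  exact: truncnS_gt.
have : ~ lim_sup_set (F k) w by move=> h; apply: hF; exists k.
move=> /existsNP[n] /not_implyP[_ hn].
exists n => // i /= ni; rewrite sub0r normrN; apply: lt_trans ke.
rewrite ltNge; apply/negP => h; apply: hn; exists i => //.
Qed.

End AlmostSure.

(** In the simplex every other coordinate is at most 1 - x_o. *)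
Lemma simplex_cvg_vertex (R : realType) (d : nat) (o : 'I_d) (x : nat -> 'rV[R]_d) :
  (forall n, simplex (x n)) -> 1 - x n 0 o @[n --> \oo] --> 0 ->
  x n @[n --> \oo] --> (delta_mx 0 o : 'rV[R]_d).
Proof.
move=> hx /cvgrPdist_lt ho; apply/cvg_ballP => e e0.
have [N _ hN] := ho e e0; exists N => // n Nn /=; split => // i j.
rewrite (ord1 i) mxE eqxx -ball_normE /ball_ /=.
have := hN n Nn; rewrite sub0r normrN => h; apply: le_lt_trans h.
have y0 : 0 <= 1 - x n 0 o by rewrite subr_ge0 simplex_le1.
case: (eqVneq j o) => [->|jo]; first by [].
rewrite ?mulr0n sub0r normrN !ger0_norm ?((hx n).1)//.
rewrite -(sum_others o (hx n)) (bigD1 j)//= lerDl sumr_ge0// => l _; exact: (hx n).1.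
Qed.

Lemma nat_large (R : realType) (e M : R) : 0 < e -> exists k : nat, M <= e * k%:R.
Proof.
move=> e0; exists (Num.truncn (M / e)).+1; rewrite mulrC -ler_pdivrMr// ltW//.
exact: truncnS_gt.
Qed.

Theorem proposition3p1 (disp : measure_display) (T : measurableType disp)
    (R : realType) (P : probability T R)
    (d : nat) (hd : (1 < d)%N)
    (p : 'I_d -> R) (hp01 : forall j, 0 < p j < 1)
    (hp_anti : forall i j : 'I_d, (i <= j)%N -> p j <= p i)
    (hp_best : p (arm2 hd) < p (arm1 hd))
    (sigma : R) (hsigma : 0 < sigma <= 1)
    (alpha beta gamma1 rho1 : R)
    (halpha : 0 < alpha) (hbeta : 0 < beta)
    (hgamma1 : 0 < gamma1 < 1) (hrho1 : 0 < rho1 < 1)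
    (x0 : 'rV[R]_d)
    (A : nat -> 'I_d -> {RV P >-> bool}) (B : nat -> {RV P >-> bool})
    (I : nat -> T -> 'I_d) (X : nat -> T -> 'rV[R]_d)
    (hX : over_penalized_NS A B I p sigma
            (power_step gamma1 alpha) (power_step rho1 beta) x0 X) :
  (0 < beta <= alpha -> alpha + beta <= 1 ->
     {ae P, forall w, X n w @[n --> \oo] --> (delta_mx 0 (arm1 hd) : 'rV[R]_d)})
  /\
  (0 < beta < alpha -> alpha + beta < 1 ->
     forall i : 'I_d, i != arm1 hd ->
     {ae P, forall w,
        (X n w 0 i / power_step rho1 beta n) @[n --> \oo] -->
          (1 - sigma * p (arm1 hd)) / ((d%:R - 1) * (p (arm1 hd) - p i))}).
Proof.
set o := arm1 hd; set delta := p o - p (arm2 hd).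
have hdelta : 0 < delta by rewrite subr_gt0.
have hgap i : i != o -> p i <= p o - delta.
  move=> io; rewrite /delta opprB addrC subrK; apply: hp_anti.
  by rewrite /= lt0n; apply: contra io => /eqP i0; apply/eqP/val_inj.
have hg n : 0 <= power_step gamma1 alpha n.+1 <= 1 by apply: power_step01 => //; exact: ltW.
have hr n : 0 <= power_step rho1 beta n.+1 <= 1 by apply: power_step01 => //; exact: ltW.
have hx0 := simplex_start hX.
have hXs n w : simplex (X n w) := simplex_state hd hg hr hX n w.
have /andP[r10 r11] := hrho1.
split.
  move=> /andP[_ hab] habs; have ha1 : alpha < 1 by lra.
  (* The moment of order 2 (k + 1) decays like n^(- 2 beta (k + 1)), and 2 <= beta k makes this
     summable. *)
  have [k hk] := nat_large 2 hbeta.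
  have [C [N [C0 hC]]] := best_arm_moment hd hp01 hsigma hdelta hgap halpha ha1 hbeta hab hgamma1 hrho1 hx0 (2 * k).
  suff: {ae P, forall w, 1 - X n w 0 o @[n --> \oo] --> 0}.
    by apply: filterS => w; apply: simplex_cvg_vertex => n; exact: hXs.
  apply: (@ae_cvg0 _ _ _ _ _ hd _ hp01 _ hsigma _ _ hg hr _ _ _ _ _ hX (fun _ x => 1 - x 0 o) k.+1 C (maxn N 1)).
  move=> n; rewrite geq_max mulnS => /andP[Nn n0]; apply: (le_trans (hC n Nn)).
  apply: ler_wpM2l => //; rewrite power_step_exp -[leRHS]mul1r; apply: ler_pM.
  - by rewrite exprn_ge0// ltW.
  - exact: powR_ge0.
  - by rewrite exprn_ile1// ltW.
  - apply: natr_powR_nincr => //; apply: (le_trans hk); apply: ler_wpM2l; first exact: ltW.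
    by rewrite ler_nat mul2n -addnn -!addnS leq_addr.
move=> /andP[_ hab] habs i io; have ha1 : alpha < 1 by lra.
set c := _ / _.
pose e0 := Num.min beta (Num.min (1 - alpha) (alpha - beta)).
have e00 : 0 < e0 by rewrite !lt_min hbeta !subr_gt0 ha1.
have e0b : e0 <= beta by rewrite ge_min lexx.
have e0a : e0 <= 1 - alpha by rewrite !ge_min lexx orbT.
have e0ab : e0 <= alpha - beta by rewrite !ge_min lexx !orbT.
(* Dividing the moment by rho_n^(2 (j + 2)) leaves n^(- e0 (j + 2)), at most n^(-2). *)
have [j hj] := nat_large 2 e00.
have [C [N [C0 hC]]] := other_arm_moment hd hp01 hsigma hdelta hgap halpha ha1 hbeta hab hgamma1 hrho1 hx0 j io e00 e0b e0a e0ab.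
pose rho := power_step rho1 beta.
suff : {ae P, forall w, X n w 0 i / rho n - c @[n --> \oo] --> 0}.
  by apply: filterS => w h; apply: cvg_zero; exact: h.
apply: (@ae_cvg0 _ _ _ _ _ hd _ hp01 _ hsigma _ _ hg hr _ _ _ _ _ hX (fun n x => x 0 i / rho n - c) j.+2 C (maxn N 1)).
move=> [|n]; rewrite geq_max => /andP[Nn n0]//.
have rn0 : 0 < rho n.+1 by exact: power_step_gt0.
have rnk : 0 < rho n.+1 ^+ (2 * j.+2) by rewrite exprn_gt0.
apply: (@le_trans _ _ ((rho n.+1 ^+ (2 * j.+2))^-1 * (C * (rho n.+1 ^+ (2 * j.+2) * (n.+1%:R `^ (- e0)) ^+ j.+2)))).
  apply: (le_trans _ (ler_wpM2l _ (hC _ Nn))); last by rewrite invr_ge0 ltW.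
  rewrite -evolve_scale; apply: (@evolve_le R d hd p hp01 sigma hsigma _ _ hg hr) => [|x _]; first exact: hx0.
  rewrite -exprVn -exprMn le_eqVlt; apply/orP; left; apply/eqP; congr (_ ^+ _).
  by rewrite -/c -/rho; field; rewrite gt_eqF.
rewrite mulrCA; apply: ler_wpM2l => //; rewrite mulKf ?gt_eqF//.
rewrite -powR_mulrn ?powR_ge0// -powRrM mulNr.
apply: natr_powR_nincr => //; apply: (le_trans hj); apply: ler_wpM2l; first exact: ltW.
by rewrite ler_nat -addn2 leq_addr.
Qed.
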